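(* Let $m\ge3$ and $\lambda_m=(2\lfloor m/2\rfloor+2)\pi$. For any $r>0$ and $c>1$, there exists an $(r,cr)$-LSH structure for the polygonal $D_1$ distance for $n$ polygons, each with at most $m$ vertices. This structure requires $O((nm^2)^{1+\rho})$ extra space and preprocessing time, and $O(m^{2+2\rho}n^{\rho}\log(nm))$ query time, where \[\rho=\frac{\log\left(1-\frac{r}{\lambda_m+4\pi}\right)}{\log\left(1-\frac{cr}{\lambda_m+4\pi}\right)}.\]
   Context: Polygons are simple, with no three consecutive vertices collinear. For such a polygon $P$ scaled to perimeter $1$ with a reference point $O$ on its boundary, the turning function $t_P:[0,1]\to\mathbb{R}$ gives the cumulative angle between the $x$-axis and the counterclockwise tangent at the boundary point at counterclockwise arc-length $s$ from $O$ (with $t_P(0)\in[0,2\pi)$, constant on edges, changing at vertices by the signed turning angle). The $2\pi$-extension of $f:[0,1]\to\mathbb{R}$ is $f^{2\pi}(x)=f(x)$ on $[0,1]$, $f^{2\pi}(x)=f(x-1)+2\pi$ on $(1,2]$; $D_1(f,g)=\min_{\alpha\in\mathbb{R},\,u\in[0,1]}\int_0^1|f^{2\pi}(x+u)+\alpha-g(x)|\,dx$, and $D_1(P,Q)=D_1(t_P,t_Q)$. An $(r,cr)$-LSH structure for a distance $d$ is a data structure storing $n$ data objects such that, for any query $q$, if some data object is at distance at most $r$ from $q$, then with constant probability it returns a data object at distance at most $cr$ from $q$. Complexity bounds suppress the factor $1/p_1$ and the time to evaluate a hash or a distance. *)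

(* Defs.v *)
From HB Require Import structures.
From mathcomp Require Import all_boot all_order all_algebra.
From mathcomp Require Import all_classical all_reals all_analysis.

Set Implicit Arguments.
Unset Strict Implicit.
Unset Printing Implicit Defensive.

Import Order.TTheory GRing.Theory Num.Theory.
Import numFieldNormedType.Exports.

Local Open Scope classical_set_scope.
Local Open Scope ring_scope.

(** * Polygons *)

Section Plane.
Variable R : realType.
Implicit Types u v : R * R.

Definition norm2 v : R := Num.sqrt (v.1 ^+ 2 + v.2 ^+ 2).
Definition dot u v : R := u.1 * v.1 + u.2 * v.2.
Definition cross u v : R := u.1 * v.2 - u.2 * v.1.

(* Angle in [0, 2 pi) from the x-axis to v, for v != 0. *)
Definition direction v : R :=
  if 0 <= v.2 then acos (v.1 / norm2 v) else 2 * pi - acos (v.1 / norm2 v).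

(* Signed angle in (- pi, pi) from u to v, positive when v is to the left of u;
   meaningful when u and v are not collinear. *)
Definition turning u v : R :=
  Num.sg (cross u v) * acos (dot u v / (norm2 u * norm2 v)).

(* A polygon is given by the list of its vertices; indices are read cyclically,
   and edge i goes from vertex i to vertex i.+1. *)
Variable vs : seq (R * R).

Definition vertex (i : nat) : R * R := nth (0, 0) vs (i %% size vs).
Definition edge (i : nat) : R * R := vertex i.+1 - vertex i.
Definition edge_point (i : nat) (s : R) : R * R :=
  ((1 - s) * (vertex i).1 + s * (vertex i.+1).1,
   (1 - s) * (vertex i).2 + s * (vertex i.+1).2).

(* Every point of the closed boundary curve lies on exactly one half-open edge,
   at exactly one position. *)
Definition simple_polygon : Prop :=
  forall (i j : nat) (s t : R),
    (i < size vs)%N -> (j < size vs)%N -> 0 <= s < 1 -> 0 <= t < 1 ->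
    edge_point i s = edge_point j t -> i = j /\ s = t.

Definition no_three_collinear : Prop :=
  forall i : nat, cross (edge i) (edge i.+1) != 0.

Definition lexi_le u v : Prop := u.1 < v.1 \/ (u.1 = v.1 /\ u.2 <= v.2).

(* Orientation test at an extreme point: the boundary of a simple polygon is
   traversed counterclockwise when it turns left at its lexicographically
   smallest vertex, which is a vertex of the convex hull. *)
Definition counterclockwise : Prop :=
  forall i : nat, (forall j, lexi_le (vertex i.+1) (vertex j)) ->
    0 < cross (edge i) (edge i.+1).

End Plane.

(* A polygon with a reference point O on its boundary.  The numbering of the
   vertices starts so that O lies on the half-open edge 0, at fraction [origin]
   of this edge. *)
Record polygon (R : realType) := Polygon {
  verts : seq (R * R);
  origin : R;
  polygon_size : (3 <= size verts)%N;
  polygon_simple : simple_polygon verts;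
  polygon_corners : no_three_collinear verts;
  polygon_ccw : counterclockwise verts;
  origin_range : 0 <= origin < 1 }.

Section TurningFunction.
Variables (R : realType) (P : polygon R).

(* Length of the boundary from vertex 0 to vertex j. *)
Definition boundary_length (j : nat) : R :=
  \sum_(i < j) norm2 (edge (verts P) i).

Definition perimeter : R := boundary_length (size (verts P)).

(* Arc length measured from vertex 0 of the point at normalized arc length s
   from the reference point. *)
Definition arc_position (s : R) : R :=
  origin P * boundary_length 1 + s * perimeter.

(* At a vertex the value is that of the outgoing edge.  For s in [0, 1] the
   vertices passed are among 1, ..., size (verts P), the last one being
   vertex 0 again. *)
Definition turning_function (s : R) : R :=
  direction (edge (verts P) 0) +
  \sum_(i < size (verts P) | boundary_length i.+1 <= arc_position s)
     turning (edge (verts P) i) (edge (verts P) i.+1).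

End TurningFunction.

(** * The D_1 distance *)

Section D1.
Variable R : realType.

(* Only the restriction of f to [0, 1] and the values of the result on [0, 2]
   are used. *)
Definition ext2pi (f : R -> R) (x : R) : R :=
  if x <= 1 then f x else f (x - 1) + 2 * pi.

Definition D1fun (f g : R -> R) : R :=
  inf [set v | exists (alpha u : R), 0 <= u <= 1 /\
     v = \int[lebesgue_measure]_(x in `[0, 1]) `|ext2pi f (x + u) + alpha - g x|].

Definition D1 (P Q : polygon R) : R :=
  D1fun (turning_function P) (turning_function Q).

Definition lambda (m : nat) : R := (2 * m./2 + 2)%N%:R * pi.

(* The quotient of logarithms is meaningful for c * r < lambda m + 4 * pi; for
   larger c * r the conventions on ln and on division give the value 0. *)
Definition rho (m : nat) (r c : R) : R :=
  ln (1 - r / (lambda m + 4 * pi)) / ln (1 - c * r / (lambda m + 4 * pi)).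

End D1.

(** * Word RAM with unit-cost hash and distance oracles *)

Inductive binop := OAdd | OSub | OMul | ODiv | OMod | OLt | OEq.

Definition eval_binop (o : binop) (a b : nat) : nat :=
  match o with
  | OAdd => a + b | OSub => a - b | OMul => a * b
  | ODiv => a %/ b | OMod => a %% b
  | OLt => (a < b)%N | OEq => (a == b)%N
  end%N.

Inductive expr :=
  | Const of nat
  | Reg of nat
  | Bin of binop & expr & expr.

(* Registers are named by numbers; a given program uses finitely many. *)
Inductive cmd :=
  | Assign of nat & expr              (* x := e *)
  | Read of nat & expr              (* x := mem[e] *)
  | Write of expr & expr            (* mem[e1] := e2 *)
  | Hash of nat & expr & expr       (* x := h_e1 (object e2) *)
  | Near of nat & expr & expr       (* x := [d (object e1) (object e2) <= threshold] *)
  | Seq of cmd & cmd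
  | If of expr & cmd & cmd
  | While of expr & cmd.

Record env (Obj : Type) := Env {
  wordmod : nat;                    (* words are the numbers below wordmod *)
  cells : nat;                      (* memory cells are 0, ..., cells - 1 *)
  nhash : nat;                      (* hash functions are h_0, ..., h_(nhash - 1) *)
  hash : nat -> Obj -> nat;
  near : Obj -> Obj -> bool;
  object : nat -> option Obj }.

Definition upd (f : nat -> nat) (x v : nat) : nat -> nat :=
  fun y => if y == x then v else f y.

Section Semantics.
Variables (Obj : Type) (E : env Obj).
Local Open Scope nat_scope.

Fixpoint eval (rg : nat -> nat) (e : expr) : nat :=
  match e with
  | Const k => k %% wordmod E
  | Reg x => rg x
  | Bin o e1 e2 => eval_binop o (eval rg e1) (eval rg e2) %% wordmod E
  end.

Fixpoint ecost (e : expr) : nat :=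
  if e is Bin _ e1 e2 then (ecost e1 + ecost e2).+1 else 1.

(* exec C (rg, mem) (rg', mem') t: from registers rg and memory mem, C halts in
   time t with registers rg' and memory mem'.  Accesses to non-existing cells,
   hash functions or objects have no execution. *)
Inductive exec :
    cmd -> (nat -> nat) * (nat -> nat) -> (nat -> nat) * (nat -> nat) ->
    nat -> Prop :=
  | ExAssign rg mem x e :
      exec (Assign x e) (rg, mem) (upd rg x (eval rg e), mem) (ecost e).+1
  | ExRead rg mem x e :
      eval rg e < cells E ->
      exec (Read x e) (rg, mem) (upd rg x (mem (eval rg e)), mem) (ecost e).+1
  | ExWrite rg mem e1 e2 :
      eval rg e1 < cells E ->
      exec (Write e1 e2) (rg, mem) (rg, upd mem (eval rg e1) (eval rg e2))
        (ecost e1 + ecost e2).+1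
  | ExHash rg mem x e1 e2 p :
      eval rg e1 < nhash E -> object E (eval rg e2) = Some p ->
      exec (Hash x e1 e2) (rg, mem)
        (upd rg x (hash E (eval rg e1) p %% wordmod E), mem)
        (ecost e1 + ecost e2).+1
  | ExNear rg mem x e1 e2 p q :
      object E (eval rg e1) = Some p -> object E (eval rg e2) = Some q ->
      exec (Near x e1 e2) (rg, mem)
        (upd rg x (near E p q %% wordmod E), mem)
        (ecost e1 + ecost e2).+1
  | ExSeq C1 C2 st1 st2 st3 t1 t2 :
      exec C1 st1 st2 t1 -> exec C2 st2 st3 t2 ->
      exec (Seq C1 C2) st1 st3 (t1 + t2)
  | ExIfT rg mem e C1 C2 st t :
      eval rg e != 0 -> exec C1 (rg, mem) st t ->
      exec (If e C1 C2) (rg, mem) st (ecost e + t).+1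
  | ExIfF rg mem e C1 C2 st t :
      eval rg e == 0 -> exec C2 (rg, mem) st t ->
      exec (If e C1 C2) (rg, mem) st (ecost e + t).+1
  | ExWhileT rg mem e C st1 st2 t1 t2 :
      eval rg e != 0 -> exec C (rg, mem) st1 t1 -> exec (While e C) st1 st2 t2 ->
      exec (While e C) (rg, mem) st2 (ecost e + t1 + t2).+1
  | ExWhileF rg mem e C :
      eval rg e == 0 -> exec (While e C) (rg, mem) (rg, mem) (ecost e).+1.

End Semantics.

(** * LSH structures *)

Section LSH.
Variables (R : realType) (Obj : Type) (d : Obj -> Obj -> R).

Definition data_objects (n : nat) (data : 'I_n -> Obj) : nat -> option Obj :=
  fun i => omap data (insub i).

(* At query time the query is object n. *)
Definition query_objects (n : nat) (data : 'I_n -> Obj) (q : Obj) :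
    nat -> option Obj :=
  fun i => if (i == n)%N then Some q else data_objects data i.

(* [lsh_structure d A r s p0 n W pre qry space ptime qtime]: the programs [pre]
   and [qry] on words below W implement an (r, s)-LSH structure for n objects
   of the class A, with success probability p0 and the given bounds on extra
   space, preprocessing time and query time.
   - The hash functions h w 0, ..., h w (nh - 1) are drawn (w is the outcome)
     independently of the data and of the query; each counts for one unit of
     space and one unit of preprocessing time.  The objects themselves are
     accessible only through the hash and distance oracles and are not counted.
   - [par] is the initial content of the registers.  It cannot depend on the
     data, the query or the outcome.
   - The memory starts filled with zeros, only the memory is passed from
     preprocessing to queries, and a query gives it back unchanged.  The answer
     is the index left in register 0.
   - The time bounds hold for all outcomes.  The success event is only required
     to contain a measurable event of probability at least p0. *)
Definition lsh_structure (A : Obj -> Prop) (r s p0 : R) (n W : nat)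
    (pre qry : cmd) (space ptime qtime : R) : Prop :=
  exists (disp : measure_display) (Omega : measurableType disp)
    (Pr : probability Omega R)
    (nh : nat) (h : Omega -> nat -> Obj -> nat) (S : nat) (par : nat -> nat),
  let E w objs := Env W S nh (h w) (fun x y => d x y <= s) objs in
  let init x := (par x %% W)%N in
  (S + nh)%:R <= space /\
  forall data : 'I_n -> Obj, (forall i, A (data i)) ->
  exists M : Omega -> nat -> nat,
    (forall w, exists rg t,
       exec (E w (data_objects data)) pre (init, fun=> 0%N) (rg, M w) t /\
       (nh + t)%:R <= ptime) /\
    forall q : Obj, A q ->
    exists answer : Omega -> nat,
      (forall w, exists rg t,
         [/\ exec (E w (query_objects data q)) qry (init, M w) (rg, M w) t,
             t%:R <= qtime & answer w = rg 0%N]) /\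
      ((exists i, d (data i) q <= r) ->
       exists G : set Omega,
         [/\ measurable G, (p0%:E <= Pr G)%E &
             forall w, G w ->
               exists i : 'I_n, answer w = i /\ d (data i) q <= s]).

End LSH.

(* Main.v *)
(** For fixed alpha the integral of |f(x + u) + alpha - g(x)| is an affine function
of u between two shifts that align a vertex of P with a vertex of Q, and for fixed u
a median of the values of g - f is an optimal alpha.  Hence D_1(P, Q) is the least L1
distance between one of at most m^2 canonical step functions of P (started at a
vertex, and normalized to be 0 on an edge) and one of those of Q.  The total turning
of a simple polygon is 2 pi (Hopf's Umlaufsatz), which bounds all canonical functions
by lambda_m / 2; so a random point (x, y) of [0, 1] x [- c, c] with
2 c = lambda_m + 4 pi lies on different sides of two of them with probability their
L1 distance over 2 c.  Concatenating about ln N / ln (1 / p2) such bits, N = n m^2,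
and mapping the result to N slots by a random function, a pair at distance at most r
collides with probability at least p1 N^(- rho), and a pair at distance more than c r
with probability at most 2 / N.  About N^rho / p1 independent tables therefore catch
a close pair with probability at least 1/2, and by Markov's inequality a query
visits more than 8 L m^2 far entries of the L tables with probability at most 1/4. *)

Require Import Defs.
From HB Require Import structures.
From mathcomp Require Import all_boot all_order all_algebra.
From mathcomp Require Import all_classical all_reals all_analysis.
From mathcomp Require Import measurable_realfun.
From mathcomp Require Import ring lra zify.

Set Implicit Arguments.
Unset Strict Implicit.
Unset Printing Implicit Defensive.

Import Order.TTheory GRing.Theory Num.Theory.
Import numFieldNormedType.Exports.

Local Open Scope ring_scope.

(** * Total turning of a simple polygon *)

(** [D1] minimizes over shift and offset jointly, whereas a hash value may depend on one polygon
    only. Hashing is possible because an optimal offset, a median of a difference of two step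
    functions, is itself the difference of a value of one and a value of the other: shift and offset
    together split into a choice for P and a choice for Q, so each polygon can be stored, or
    queried, under all its normalizations. The programs, [kappa] and [K] have to be chosen before m
    and n. For c r < lambda_m + 4 pi the probability p1 is at least 1 - 1 / c, which bounds the
    price 1 / p1 of rounding up the number of bits; for larger c r every object is an acceptable
    answer. Time bounds must hold for all outcomes, while Markov's inequality only speaks of most of
    them; therefore the query program carries a budget of far entries and gives up when it is
    spent. *)

Section Turning.
Variable R : realType.
Implicit Types (u v w : R * R) (a b c x : R).

Lemma norm2_sqr v : norm2 v ^+ 2 = v.1 ^+ 2 + v.2 ^+ 2.
Proof. by rewrite sqr_sqrtr // addr_ge0 // sqr_ge0. Qed.

Lemma norm2_gt0 v : (0 < norm2 v) = (v != 0).
Proof.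
rewrite /norm2 sqrtr_gt0; case: v => v1 v2 /=; rewrite xpair_eqE negb_and.
rewrite lt_def addr_ge0 ?sqr_ge0 // andbT paddr_eq0 ?sqr_ge0 //.
by rewrite !sqrf_eq0 negb_and.
Qed.

Lemma crossC u v : cross v u = - cross u v.
Proof. by rewrite /cross; ring. Qed.

Lemma dotC u v : dot v u = dot u v.
Proof. by rewrite /dot; ring. Qed.

Lemma dot_cross_sqr u v :
  dot u v ^+ 2 + cross u v ^+ 2 = (norm2 u * norm2 v) ^+ 2.
Proof. by rewrite exprMn !norm2_sqr /dot /cross; ring. Qed.

Lemma turningC u v : turning v u = - turning u v.
Proof. by rewrite /turning crossC dotC sgrN mulNr [norm2 v * _]mulrC. Qed.

Lemma turningvv u : turning u u = 0.
Proof. by rewrite /turning /cross [u.2 * _]mulrC subrr sgr0 mul0r. Qed.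

Definition cosine u v := dot u v / (norm2 u * norm2 v).

Lemma cosine_range u v : -1 <= cosine u v <= 1.
Proof.
have [->|u0] := eqVneq u 0; first by rewrite /cosine /dot /= !mul0r addr0 mul0r; lra.
have [->|v0] := eqVneq v 0; first by rewrite /cosine /dot /= !mulr0 addr0 mul0r; lra.
have n0 : 0 < norm2 u * norm2 v by rewrite mulr_gt0 ?norm2_gt0.
rewrite -ler_norml /cosine normrM normfV (gtr0_norm n0) ler_pdivrMr // mul1r.
rewrite -(@ler_pXn2r _ 2) ?nnegrE ?(ltW n0) //.
by rewrite real_normK ?num_real // -dot_cross_sqr lerDl sqr_ge0.
Qed.

Lemma turning_abs_le u v : `|turning u v| <= pi.
Proof.
have cr := cosine_range u v.
rewrite /turning normrM (ger0_norm (acos_ge0 cr)) normr_sg.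
by case: eqP => /= _; rewrite ?mul0r ?pi_ge0 // mul1r acos_lepi.
Qed.

(** Excludes opposite directions, where the sign factor makes [turning] 0 although the angle is pi;
    under this condition both sine and cosine of [turning] are the expected ones. *)
Definition unopposed u v :=
  [&& u != 0, v != 0 & (cross u v != 0) || (0 < dot u v)].

Lemma sin_turning u v : u != 0 -> v != 0 ->
  sin (turning u v) = cross u v / (norm2 u * norm2 v).
Proof.
move=> u0 v0; have cr := cosine_range u v.
have n0 : 0 < norm2 u * norm2 v by rewrite mulr_gt0 ?norm2_gt0.
have sE : sin (acos (cosine u v)) = `|cross u v| / (norm2 u * norm2 v).
  rewrite sin_acos // /cosine.
  have -> : 1 - (dot u v / (norm2 u * norm2 v)) ^+ 2 =
            (cross u v / (norm2 u * norm2 v)) ^+ 2.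
    rewrite !expr_div_n -[X in X - _](@divff _ ((norm2 u * norm2 v) ^+ 2)) ?sqrf_eq0 ?gt_eqF //.
    by rewrite -mulrBl -dot_cross_sqr addrAC subrr add0r.
  by rewrite sqrtr_sqr normrM normfV (gtr0_norm n0).
rewrite /turning -/(cosine u v).
case: (ltrgt0P (cross u v)) => c0.
- by rewrite gtr0_sg // mul1r sE gtr0_norm.
- by rewrite ltr0_sg // mulN1r sinN sE ltr0_norm // mulNr opprK.
- by rewrite c0 sgr0 !mul0r sin0.
Qed.

Lemma cos_turning u v : unopposed u v -> cos (turning u v) = cosine u v.
Proof.
case/and3P => u0 v0 uv; have cr := cosine_range u v.
have n0 : 0 < norm2 u * norm2 v by rewrite mulr_gt0 ?norm2_gt0.
rewrite /turning -/(cosine u v).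
case: (ltrgt0P (cross u v)) => c0.
- by rewrite gtr0_sg // mul1r acosK // in_itv.
- by rewrite ltr0_sg // mulN1r cosN acosK // in_itv.
- rewrite c0 sgr0 mul0r cos0; move: uv; rewrite c0 eqxx /= => d0.
  rewrite /cosine; suff -> : dot u v = norm2 u * norm2 v by rewrite divff // gt_eqF.
  apply/eqP; rewrite -(@eqrXn2 _ 2) ?(ltW n0) ?(ltW d0) //.
  by rewrite -dot_cross_sqr c0 expr0n addr0.
Qed.

Lemma turning_abs_lt u v : unopposed u v -> `|turning u v| < pi.
Proof.
move=> uv; rewrite lt_neqAle turning_abs_le andbT; apply/eqP => e.
have := cos_turning uv; have := sin_turning (proj1 (andP uv)) (proj1 (andP (proj2 (andP uv)))).
have n0 : 0 < norm2 u * norm2 v.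
  by case/and3P: uv => *; rewrite mulr_gt0 ?norm2_gt0.
have ca : cos (turning u v) = -1.
  by rewrite -[RHS](@cospi R) -e; case: (ler0P (turning u v)) => // _; rewrite cosN.
have : sin (turning u v) ^+ 2 = 0 by rewrite sin2cos2 ca; ring.
move/eqP; rewrite sqrf_eq0 => /eqP -> /esym/eqP.
rewrite mulf_eq0 invr_eq0 (gt_eqF n0) orbF => /eqP c0.
rewrite ca => /eqP; case/and3P: uv => _ _; rewrite c0 eqxx /= => d0.
by apply/negP; rewrite lt_eqF // (lt_trans (ltrN10 R)) // divr_gt0.
Qed.

Lemma turning_gt0 u v : unopposed u v -> (0 < turning u v) = (0 < cross u v).
Proof.
move=> uv; have cr := cosine_range u v.
rewrite /turning -/(cosine u v).
case: (ltrgt0P (cross u v)) => c0.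
- rewrite gtr0_sg // mul1r lt_neqAle acos_ge0 // andbT; apply/eqP => e.
  have := turning_abs_lt uv; have := cos_turning uv.
  have := sin_turning (proj1 (andP uv)) (proj1 (andP (proj2 (andP uv)))).
  rewrite /turning gtr0_sg // mul1r -/(cosine u v) -e sin0 => /esym/eqP.
  have n0 : 0 < norm2 u * norm2 v.
    by case/and3P: uv => *; rewrite mulr_gt0 ?norm2_gt0.
  by rewrite mulf_eq0 invr_eq0 (gt_eqF n0) orbF (gt_eqF c0).
- by rewrite ltr0_sg // mulN1r; apply/negbTE; rewrite -leNgt oppr_le0 acos_ge0.
- by rewrite c0 sgr0 mul0r ltxx.
Qed.

Lemma cos_eq1_small x : `|x| < pi *+ 2 -> cos x = 1 -> x = 0.
Proof.
move=> xlt c1; have : cos (x / 2 + x / 2) = 1 by rewrite -[RHS]c1; congr cos; field.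
rewrite cosD -!expr2 cos2sin2 => e.
have {e} : sin (x / 2) ^+ 2 = 0 by lra.
move/eqP; rewrite sqrf_eq0 => /eqP s0.
case: (ltrgt0P x) => // x0.
- have : 0 < sin (x / 2).
    by apply: sin_gt0_pi; move: xlt; rewrite gtr0_norm // mulr2n => xlt; lra.
  by rewrite s0 ltxx.
- have : 0 < sin (- (x / 2)).
    by apply: sin_gt0_pi; move: xlt; rewrite ltr0_norm // mulr2n => xlt; lra.
  by rewrite sinN s0 oppr0 ltxx.
Qed.

(** For vectors read as complex numbers, the product of conj(u) v, conj(v) w and conj(w) u is
    positive, so the three angles add up to a multiple of 2 pi. Each is below pi in absolute value
    and they are neither all positive nor all negative, which leaves only 0. *)
Lemma turning_cycle u v w :
  unopposed u v -> unopposed v w -> unopposed w u ->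
  ~~ [&& 0 < cross u v, 0 < cross v w & 0 < cross w u] ->
  ~~ [&& 0 < cross v u, 0 < cross w v & 0 < cross u w] ->
  turning u v + turning v w + turning w u = 0.
Proof.
move=> uv vw wu P N.
have unopC (y z : R * R) : unopposed y z -> unopposed z y.
  case/and3P => y0 z0; rewrite /unopposed y0 z0 dotC (crossC y).
  by rewrite oppr_eq0.
have := turning_abs_lt uv; have := turning_abs_lt vw; have := turning_abs_lt wu.
rewrite -!(turning_gt0 uv, turning_gt0 vw, turning_gt0 wu) in P.
rewrite -!(turning_gt0 (unopC _ _ uv), turning_gt0 (unopC _ _ vw), turning_gt0 (unopC _ _ wu)) in N.
rewrite (turningC u v) (turningC v w) (turningC w u) !oppr_gt0 in N.
rewrite !ltr_norml => /andP[] ? ? /andP[] ? ? /andP[] ? ?.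
apply: cos_eq1_small.
  rewrite ltr_norml mulr2n; apply/andP; split.
    by move: N; rewrite !negb_and -!leNgt => /or3P[] ?; lra.
  by move: P; rewrite !negb_and -!leNgt => /or3P[] ?; lra.
have [u0 v0 w0] : [/\ u != 0, v != 0 & w != 0].
  by case/and3P: uv => ? ? _; case/and3P: vw.
rewrite !(cosD, sinD) !cos_turning // !sin_turning // /cosine.
have nz (z : R * R) : z != 0 -> norm2 z != 0 by rewrite -norm2_gt0 => /lt0r_neq0.
have e : norm2 u ^+ 2 * norm2 v ^+ 2 * norm2 w ^+ 2 =
  (dot u v * dot v w - cross u v * cross v w) * dot w u
  - (cross u v * dot v w + dot u v * cross v w) * cross w u.
  by rewrite !norm2_sqr /dot /cross; ring.
have nz2 : norm2 u ^+ 2 * norm2 v ^+ 2 * norm2 w ^+ 2 != 0.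
  by rewrite !mulf_neq0 // nz.
apply: (mulIf nz2); rewrite mul1r [RHS]e; field.
by rewrite !nz.
Qed.

Lemma unopposed_hull u v :
  (forall a b, 0 <= a -> 0 <= b -> 0 < a + b ->
     (a * u.1 + b * v.1, a * u.2 + b * v.2) != (0, 0)) ->
  unopposed u v.
Proof.
move=> H; apply/and3P; split.
- apply/eqP => u0; have /eqP := H 1 0 ler01 (lexx _) ltac:(lra).
  by apply; rewrite u0 /=; congr pair; ring.
- apply/eqP => v0; have /eqP := H 0 1 (lexx _) ler01 ltac:(lra).
  by apply; rewrite v0 /=; congr pair; ring.
rewrite -implyNb negbK; apply/implyP => /eqP c0; rewrite ltNge; apply/negP => d0.
have [v0|v0] := eqVneq v 0.
  have /eqP := H 0 1 (lexx _) ler01 ltac:(lra).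
  by apply; rewrite v0 /=; congr pair; ring.
have n0 : 0 < norm2 v ^+ 2 by rewrite exprn_gt0 // norm2_gt0.
(* Parallel vectors satisfy |v|^2 u = (u . v) v, so with u . v <= 0 these are admissible weights
   that reach the origin. *)
have /eqP := H (norm2 v ^+ 2) (- dot u v) (ltW n0) ltac:(lra) ltac:(lra).
apply; rewrite norm2_sqr /dot; move: c0; rewrite /cross => c0; congr pair.
- by transitivity (v.2 * (u.1 * v.2 - u.2 * v.1)); [ring|rewrite c0 mulr0].
- by transitivity (- v.1 * (u.1 * v.2 - u.2 * v.1)); [ring|rewrite c0 mulr0].
Qed.

(* If the triangle u v w misses the origin, its vertices lie in an open half plane. *)
Lemma turningD_hull u v w :
  (forall a b c, 0 <= a -> 0 <= b -> 0 <= c -> 0 < a + b + c ->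
     (a * u.1 + b * v.1 + c * w.1, a * u.2 + b * v.2 + c * w.2) != (0, 0)) ->
  turning u v + turning v w = turning u w.
Proof.
move=> H; rewrite -[RHS]opprK -turningC; apply/eqP; rewrite -addr_eq0.
apply/eqP; apply: turning_cycle.
- apply: unopposed_hull => a b a0 b0 ab; have := H a b 0 a0 b0 (lexx _) ltac:(lra).
  by rewrite !mul0r !addr0.
- apply: unopposed_hull => b c b0 c0 bc; have := H 0 b c (lexx _) b0 c0 ltac:(lra).
  by rewrite !mul0r !add0r.
- apply: unopposed_hull => c a c0 a0 ca; have := H a 0 c a0 (lexx _) c0 ltac:(lra).
  by rewrite !mul0r !addr0 ![c * _ + _]addrC.
- apply/negP => /and3P[x y z].
  (* Any three plane vectors satisfy (v x w) u + (w x u) v + (u x v) w = 0; if the three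
     coefficients are positive, the triangle contains the origin. *)
  have /eqP := H (cross v w) (cross w u) (cross u v) (ltW y) (ltW z) (ltW x) ltac:(lra).
  by apply; rewrite /cross; congr pair; ring.
- apply/negP => /and3P[x y z].
  have /eqP := H (cross w v) (cross u w) (cross v u) (ltW y) (ltW z) (ltW x) ltac:(lra).
  by apply; rewrite /cross; congr pair; ring.
Qed.

End Turning.

(* Hopf's Umlaufsatz for polygons: the turning of the secant [v j - v i] is
   summed over the staircase from (0, 1) to (m - 1, m) next to the diagonal, and
   the cells in between allow moving the staircase to the far corner (0, m). *)
Section TotalTurning.
Variables (R : realType) (v : nat -> R * R) (m : nat).

Let sec i j := v j - v i.
Let e i := sec i i.+1.
Let seg i (s : R) : R * R :=
  ((1 - s) * (v i).1 + s * (v i.+1).1, (1 - s) * (v i).2 + s * (v i.+1).2).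

Hypothesis m3 : (3 <= m)%N.
Hypothesis v_period : forall i, v (i + m) = v i.
Hypothesis corner : forall i, cross (e i) (e i.+1) != 0.
Hypothesis disjoint_edges : forall i j (s t : R), (i.+1 < j < m)%N -> (j.+1 < m + i)%N ->
  0 <= s <= 1 -> 0 <= t <= 1 -> seg i s != seg j t.
Hypothesis lexi_min : forall l, (0 < l < m)%N -> lexi_le (v 0%N) (v l) /\ v l != v 0%N.
Hypothesis left_turn : 0 < cross (e m.-1) (e 0%N).

Local Notation T := (@turning R).

(** The middle secant is the sum of the two edges, so a combination of the three secants with
    nonnegative weights is one of two independent edges. *)
Lemma secant_corner i :
  T (sec i i.+1) (sec i i.+2) + T (sec i i.+2) (sec i.+1 i.+2) =
  T (sec i i.+1) (sec i.+1 i.+2).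
Proof.
apply: turningD_hull => a b c a0 b0 c0 abc; apply/eqP => -[h1 h2].
have := corner i; rewrite /e /cross /sec /= in h1 h2 *.
move: (v i) (v i.+1) (v i.+2) h1 h2 => [x1 y1] [x2 y2] [x3 y3] /= h1 h2 cr.
set D := (X in X != 0) in cr.
have e1 : (b + c) * D = 0.
  transitivity ((x2 - x1) * (a * (y2 - y1) + b * (y3 - y1) + c * (y3 - y2))
    - (y2 - y1) * (a * (x2 - x1) + b * (x3 - x1) + c * (x3 - x2))).
    by rewrite /D; ring.
  by rewrite h1 h2; ring.
have e2 : (a + b) * D = 0.
  transitivity ((y3 - y2) * (a * (x2 - x1) + b * (x3 - x1) + c * (x3 - x2))
    - (x3 - x2) * (a * (y2 - y1) + b * (y3 - y1) + c * (y3 - y2))).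
    by rewrite /D; ring.
  by rewrite h1 h2; ring.
move/eqP: e1; move/eqP: e2; rewrite !mulf_eq0 (negbTE cr) !orbF => /eqP ? /eqP ?.
by lra.
Qed.

(** Disjointness of two edges in homogeneous form: the points at fractions s / d and t / d are
    scaled by the total weight d = a + b + c. *)
Let hull_cell i j (a b c s t : R) : (i.+1 < j < m)%N -> (j.+1 < m + i)%N ->
  0 <= s <= a + b + c -> 0 <= t <= a + b + c -> 0 < a + b + c ->
  ((a + b + c - t) * (v j).1 + t * (v j.+1).1
    - ((a + b + c - s) * (v i).1 + s * (v i.+1).1),
   (a + b + c - t) * (v j).2 + t * (v j.+1).2
    - ((a + b + c - s) * (v i).2 + s * (v i.+1).2)) != (0, 0).
Proof.
move=> ij ji /andP[s0 s1] /andP[t0 t1] d0; set d := a + b + c in d0 s1 t1 *.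
have dn0 : d != 0 by rewrite gt_eqF.
have := @disjoint_edges i j (s / d) (t / d) ij ji.
rewrite !ler_pdivrMr // !mul1r s1 t1 !divr_ge0 //= ?(ltW d0) // => /(_ isT isT).
apply: contra => /eqP[/eqP h1 /eqP h2]; rewrite !subr_eq0 in h1 h2.
apply/eqP; congr pair; apply: (mulfI dn0).
  transitivity ((d - s) * (v i).1 + s * (v i.+1).1); first by field.
  by rewrite -(eqP h1); field.
transitivity ((d - s) * (v i).2 + s * (v i.+1).2); first by field.
by rewrite -(eqP h2); field.
Qed.

(** Both paths across the cell turn by the angle from [sec i j] to [sec i.+1 j.+1]: up to scaling,
    the points of the two triangles of secants are differences of points of the disjoint edges i and
    j, hence nonzero. *)
Lemma secant_cell i j : (i.+1 < j < m)%N -> (j.+1 < m + i)%N ->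
  T (sec i j) (sec i j.+1) + T (sec i j.+1) (sec i.+1 j.+1) =
  T (sec i j) (sec i.+1 j) + T (sec i.+1 j) (sec i.+1 j.+1).
Proof.
move=> ij ji; rewrite !turningD_hull // => a b c a0 b0 c0 abc.
- have := @hull_cell i j a b c (b + c) c ij ji ltac:(lra) ltac:(lra) abc.
  apply: contra => /eqP[h1 h2]; apply/eqP; congr pair; [rewrite -[RHS]h1|rewrite -[RHS]h2];
  by rewrite /sec /=; ring.
- have := @hull_cell i j a b c c (b + c) ij ji ltac:(lra) ltac:(lra) abc.
  apply: contra => /eqP[h1 h2]; apply/eqP; congr pair; [rewrite -[RHS]h1|rewrite -[RHS]h2];
  by rewrite /sec /=; ring.
Qed.

Let lexi_gt0 (u : R * R) := 0 < u.1 \/ u.1 = 0 /\ 0 < u.2.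

(** Lexicographically positive vectors form a convex cone without the origin, so angles add up in
    it. Seen from the lexicographically least vertex, all other vertices lie in this cone. *)
Let lexi_gt0_turningD (u w z : R * R) : lexi_gt0 u -> lexi_gt0 w -> lexi_gt0 z ->
  T u w + T w z = T u z.
Proof.
case: u w z => [u1 u2] [w1 w2] [z1 z2]; rewrite /lexi_gt0 /= => hu hw hz.
apply: turningD_hull => a b c a0 b0 c0 abc; apply/eqP => -[/= h1 h2].
have [ua wb zc] : [/\ 0 <= u1, 0 <= w1 & 0 <= z1] by split; lra.
have au : 0 <= a * u1 by rewrite mulr_ge0.
have bw : 0 <= b * w1 by rewrite mulr_ge0.
have cz : 0 <= c * z1 by rewrite mulr_ge0.
have /eqP a1 : a * u1 = 0 by lra.
have /eqP b1 : b * w1 = 0 by lra.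
have /eqP c1 : c * z1 = 0 by lra.
have k (x y p : R) : 0 < y \/ y = 0 /\ 0 < p -> x * y == 0 -> 0 <= x ->
    0 <= x * p /\ (0 < x -> 0 < x * p).
  move=> + + x0; rewrite mulf_eq0 => -[y0 /orP[/eqP->|/eqP y0']|[y0 p0] _].
  - by rewrite mul0r ltxx.
  - by move: y0; rewrite y0' ltxx.
  - by split; [rewrite mulr_ge0 // ltW|move=> ?; rewrite mulr_gt0].
have [k1 k1'] := k _ _ _ hu a1 a0.
have [k2 k2'] := k _ _ _ hw b1 b0.
have [k3 k3'] := k _ _ _ hz c1 c0.
have [a0'|a0'] := ltP 0 a; first by have := k1' a0'; lra.
have [b0'|b0'] := ltP 0 b; first by have := k2' b0'; lra.
have [c0'|c0'] := ltP 0 c; first by have := k3' c0'; lra.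
by lra.
Qed.

Let sec0_lexi l : (0 < l < m)%N -> lexi_gt0 (sec 0 l).
Proof.
move=> /lexi_min[]; rewrite /lexi_le /lexi_gt0 /sec.
case: (v 0%N) (v l) => [x y] [x' y'] /= [h _|[-> h] n]; first by left; lra.
right; split; first by lra.
by rewrite subr_gt0 lt_neqAle h andbT; apply: contraNN n => /eqP ->.
Qed.

Let turningNN (u w : R * R) : T (- u) (- w) = T u w.
Proof.
have n (z : R * R) : norm2 (- z) = norm2 z by rewrite /norm2 /= !sqrrN.
by rewrite /turning !n /cross /dot /= !mulrNN.
Qed.

Let row_sum n : (n.+1 < m)%N ->
  \sum_(0 <= l < n) T (sec 0 l.+1) (sec 0 l.+2) = T (sec 0 1) (sec 0 n.+1).
Proof.
elim: n => [|n IH] nm; first by rewrite big_geq // turningvv.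
rewrite big_nat_recr //= IH; last by lia.
by rewrite lexi_gt0_turningD //; apply: sec0_lexi; lia.
Qed.

(** Since [v m] is [v 0], the last column consists of the negated secants of row 0. *)
Let far_column_sum n : (n.+1 < m)%N ->
  \sum_(0 <= l < n) T (sec l.+1 m) (sec l.+2 m) = T (sec 1 m) (sec n.+1 m).
Proof.
move=> nm; have s l : sec l m = - sec 0 l by rewrite /sec -[m]add0n v_period opprB.
rewrite !s turningNN -row_sum //; apply: eq_bigr => l _.
by rewrite !s turningNN.
Qed.

(** Induction on the column: the cells between two neighbouring columns carry one vertical path to
    the other, and their horizontal sides telescope to the corner and to row 0. *)
Let staircase j : (0 < j < m)%N ->
  \sum_(0 <= i < j.-1) T (e i) (e i.+1) =
  \sum_(0 <= l < j.-1) T (sec 0 l.+1) (sec 0 l.+2)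
  + \sum_(0 <= i < j.-1) T (sec i j) (sec i.+1 j).
Proof.
case: j => // j /=; elim: j => [|j IH] jm; first by rewrite !big_geq // addr0.
rewrite !big_nat_recr //= IH; last by lia.
have -> : T (e j) (e j.+1) = T (sec j j.+1) (sec j j.+2) + T (sec j j.+2) (sec j.+1 j.+2).
  by rewrite secant_corner.
suff : \sum_(0 <= i < j) T (sec i j.+2) (sec i.+1 j.+2) =
   \sum_(0 <= i < j) T (sec i j.+1) (sec i.+1 j.+1)
   + (T (sec j j.+1) (sec j j.+2) - T (sec 0 j.+1) (sec 0 j.+2)).
  by move=> ->; ring.
rewrite -(telescope_sumr (fun i => T (sec i j.+1) (sec i j.+2))) // -big_split /=.
rewrite !big_nat; apply: eq_bigr => i /andP[_ ij].
have := @secant_cell i j.+1 => /(_ ltac:(lia) ltac:(lia)) h.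
by lra.
Qed.

Lemma total_turning : \sum_(0 <= i < m) T (e i) (e i.+1) = pi *+ 2.
Proof.
have vm : v m = v 0%N by rewrite -[m]add0n v_period.
have vm1 : v m.+1 = v 1%N by rewrite -add1n v_period.
have em : e m = e 0 by rewrite /e /sec vm vm1.
case: m m3 vm vm1 em left_turn secant_cell staircase row_sum far_column_sum
  => [|[|[|k]]] // _ vm vm1 em lt cell stair row far.
have {}stair := stair k.+2 (ltnSn _); rewrite /= row // [X in _ = _ + X]big_nat_recl // big_nat_recr //= in stair.
have {}far := far k.+1 (ltnSn _); rewrite big_nat_recr //= in far.
have diff : \sum_(0 <= i < k) T (sec i.+1 k.+3) (sec i.+2 k.+3) =
   \sum_(0 <= i < k) T (sec i.+1 k.+2) (sec i.+2 k.+2)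
   + (T (sec k.+1 k.+2) (sec k.+1 k.+3) - T (sec 1 k.+2) (sec 1 k.+3)).
  rewrite -(telescope_sumr (fun i => T (sec i.+1 k.+2) (sec i.+1 k.+3))) // -big_split /=.
  rewrite !big_nat; apply: eq_bigr => i /andP[_ ij].
  have := cell i.+1 k.+2 => /(_ ltac:(lia) ltac:(lia)) h.
  by lra.
have c1 := secant_corner k.+1.
have : T (- sec k.+2 k.+3) (- sec k.+2 k.+4) + T (- sec k.+2 k.+4) (- sec k.+3 k.+4) =
    T (- sec k.+2 k.+3) (- sec k.+3 k.+4) by rewrite !turningNN secant_corner.
have -> : - sec k.+2 k.+3 = sec 0 k.+2 by rewrite /sec vm opprB.
have -> : - sec k.+2 k.+4 = sec 1 k.+2 by rewrite /sec vm1 opprB.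
have -> : - sec k.+3 k.+4 = sec 1 k.+3 by rewrite /sec vm1 opprB.
move=> c2.
have f0 : sec 1 k.+3 = - e 0 by rewrite /e /sec vm opprB.
have f1 : sec 0 k.+2 = - e k.+2 by rewrite /e /sec vm opprB.
have f2 : T (sec 1 k.+3) (sec k.+2 k.+3) = T (e 0) (- e k.+2).
  by rewrite f0 -[sec _ _]opprK turningNN.
have f3 : T (sec 0 k.+2) (sec 1 k.+3) = T (e k.+2) (e 0) by rewrite f0 f1 turningNN.
(* Supplementary angles, both positive because of the left turn at vertex 0. This sum of pi enters
   the total twice. *)
have f4 : T (e 0) (- e k.+2) + T (e k.+2) (e 0) = pi.
  rewrite /turning.
  have -> : cross (e 0) (- e k.+2) = cross (e k.+2) (e 0) by rewrite /cross /=; ring.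
  have -> : dot (e 0) (- e k.+2) = - dot (e k.+2) (e 0) by rewrite /dot /=; ring.
  have -> : norm2 (- e k.+2) = norm2 (e k.+2) by rewrite /norm2 /= !sqrrN.
  have := cosine_range (e k.+2) (e 0); rewrite /cosine [norm2 (e 0) * _]mulrC mulNr => cr.
  by rewrite gtr0_sg // !mul1r acosN // subrK.
rewrite !big_nat_recr //= em.
move: stair.
have -> : T (sec 0 1) (sec 0 k.+2) = T (e 0) (- e k.+2) by rewrite f1.
move: c1 c2 diff far f2 f3 f4; rewrite -/(e k.+1) -/(e k.+2) mulr2n.
lra.
Qed.

End TotalTurning.

Lemma big_nat_period (V : nmodType) (f : nat -> V) m a : (forall i, f (i + m)%N = f i) ->
  \sum_(0 <= i < m) f (a + i)%N = \sum_(0 <= i < m) f i.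
Proof.
move=> fm; elim: a => // a <-; case: m fm => [|m] fm; first by rewrite !big_geq.
rewrite big_nat_recr //= [RHS]big_nat_recl //= addrC addSnnS fm addn0.
by congr (_ + _); apply: eq_bigr => i _; rewrite addSnnS.
Qed.

Section PolygonTurning.
Variables (R : realType) (P : polygon R).
Local Notation vs := (verts P).
Local Notation m := (size vs).

Let m0 : (0 < m)%N. Proof. exact: leq_trans (polygon_size P). Qed.

Lemma vertexD i : vertex vs (i + m) = vertex vs i.
Proof. by rewrite /vertex modnDr. Qed.

Lemma edgeD i : edge vs (i + m) = edge vs i.
Proof. by rewrite /edge -addSn !vertexD. Qed.

Lemma vertex_mod i : vertex vs (i %% m) = vertex vs i.
Proof. by rewrite /vertex modn_mod. Qed.

Lemma vertex_modS i : vertex vs (i %% m).+1 = vertex vs i.+1.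
Proof. by rewrite /vertex -addn1 modnDml addn1. Qed.

Lemma edge_point_mod i s : edge_point vs (i %% m) s = edge_point vs i s.
Proof. by rewrite /edge_point vertex_mod vertex_modS. Qed.

Lemma edge_point1 i : edge_point vs i 1 = edge_point vs i.+1 0.
Proof. by rewrite /edge_point; congr pair; ring. Qed.

Lemma edge_point_inj i j s t : 0 <= s < 1 -> 0 <= t < 1 ->
  edge_point vs i s = edge_point vs j t -> i = j %[mod m] /\ s = t.
Proof.
move=> s01 t01; rewrite -[LHS]edge_point_mod -[RHS]edge_point_mod.
by apply: (@polygon_simple R P); rewrite // ltn_mod.
Qed.

(** [simple_polygon] compares half-open edges. The missing end of an edge is the start of the next
    one, and after such a step the indices still differ by less than m. *)
Lemma edge_point_neq i j (s t : R) : (i.+1 < j)%N -> (j.+1 < m + i)%N ->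
  0 <= s <= 1 -> 0 <= t <= 1 -> edge_point vs i s != edge_point vs j t.
Proof.
have aux k l (x y : R) : (k < l < k + m)%N -> 0 <= x < 1 -> 0 <= y < 1 ->
    edge_point vs k x != edge_point vs l y.
  move=> /andP[kl lk] x1 y1; apply/eqP => /(edge_point_inj x1 y1)[/esym/eqP + _].
  rewrite eqn_mod_dvd ?(ltnW kl) // => /dvdn_leq; rewrite subn_gt0 kl => /(_ isT).
  by lia.
have r0 : 0 <= (0 : R) < 1 by lra.
move=> ij ji /andP[s0]; rewrite le_eqVlt => /predU1P[->|s1] /andP[t0];
  rewrite le_eqVlt => /predU1P[->|t1]; rewrite ?edge_point1 aux ?s0 ?t0 //; lia.
Qed.

Lemma vertex_edge_point i : vertex vs i = edge_point vs i 0.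
Proof. by rewrite /edge_point subr0 !mul1r !mul0r !addr0; case: vertex. Qed.

Lemma exists_lexi_min (v : nat -> R * R) n :
  exists2 i, (i <= n)%N & forall j, (j <= n)%N -> lexi_le (v i) (v j).
Proof.
have total (x y : R * R) : lexi_le x y \/ lexi_le y x.
  rewrite /lexi_le; case: (ltrgtP x.1 y.1) => h; [by left; left|by right; left|].
  by case: (leP x.2 y.2) => [|/ltW] k; [left|right]; right.
have trans (x y z : R * R) : lexi_le x y -> lexi_le y z -> lexi_le x z.
  rewrite /lexi_le => -[h|[h h']] [k|[k k']]; try by left; lra.
  by right; split; lra.
have refl (x : R * R) : lexi_le x x by case: (total x x).
elim: n => [|n [i i_n IH]]; first by exists 0%N => // j; rewrite leqn0 => /eqP ->.
case: (total (v i) (v n.+1)) => h.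
  exists i => [|j]; first exact: leqW.
  by rewrite leq_eqVlt => /predU1P[->|/IH].
exists n.+1 => // j; rewrite leq_eqVlt => /predU1P[->|/IH k]; first exact: refl.
exact: trans h k.
Qed.

(** The numbering is rotated to start at a lexicographically least vertex, where [polygon_ccw]
    provides the left turn that decides between 2 pi and - 2 pi. *)
Lemma polygon_total_turning :
  \sum_(i < m) turning (edge vs i) (edge vs i.+1) = pi *+ 2.
Proof.
have [i0 _ imin] := exists_lexi_min (vertex vs) m.-1.
have {}imin j : lexi_le (vertex vs i0) (vertex vs j).
  by rewrite -(vertex_mod j); apply: imin; rewrite -ltnS prednK // ltn_mod.
pose v k := vertex vs (i0 + k).
have edgeE i : edge vs (i0 + i) = v i.+1 - v i by rewrite /v addnS.
have edgeSE i : edge vs (i0 + i).+1 = v i.+2 - v i.+1 by rewrite -edgeE addnS.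
rewrite -(big_mkord xpredT (fun i => turning (edge vs i) (edge vs i.+1))).
rewrite -(@big_nat_period _ (fun i => turning (edge vs i) (edge vs i.+1)) m i0); last first.
  by move=> i; rewrite -addSn !edgeD.
under eq_bigr do rewrite edgeE edgeSE.
apply: total_turning.
- exact: polygon_size.
- by move=> i; rewrite /v addnA vertexD.
- by move=> i; rewrite -!edgeE addnS; apply: polygon_corners.
- move=> i j s t /andP[ij _] ji s1 t1; rewrite /v !addnS.
  by apply: (@edge_point_neq (i0 + i) (i0 + j)); rewrite //; lia.
- move=> l /andP[l0 lm]; split; first by rewrite /v addn0; exact: imin.
  have r0 : 0 <= (0 : R) < 1 by lra.
  rewrite /v !vertex_edge_point addn0; apply/eqP => /(edge_point_inj r0 r0)[/eqP + _].
  rewrite -{2}[i0]addn0 eqn_modDl modn_small // mod0n => /eqP l0'.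
  by rewrite l0' in l0.
- rewrite -!edgeE addn0 -[edge vs i0]edgeD -{2}(prednK m0) addnS.
  apply: polygon_ccw => j; rewrite -addnS prednK // vertexD.
  exact: imin.
Qed.

End PolygonTurning.

(** * Step functions and aligned shifts *)

Section IntervalIntegral.
Local Open Scope classical_set_scope.
Variable R : realType.
Implicit Types (f g : R -> R) (a b c u k : R).
Local Notation mu := (@lebesgue_measure R).

(** Measurable and locally bounded: this implies integrability on every bounded interval and is
    visibly stable under all operations used here. *)
Definition locally_integrable f := measurable_fun setT f /\
  forall a b, exists M, forall x, a <= x <= b -> `|f x| <= M.

(** Half-open intervals concatenate without overlap, and a step function continuous from the right
    is constant on the half-open arcs between its jumps. *)
Definition itv_integral f a b := \int[mu]_(x in `[a, b[) f x.

Lemma locally_integrable_itv f (i j : bool) a b : locally_integrable f ->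
  mu.-integrable [set` Interval (BSide i a) (BSide j b)] (EFin \o f).
Proof.
move=> [mf bf]; apply: measurable_bounded_integrable => //=.
- rewrite lebesgue_measure_itv /=; case: ifP => // _.
  by rewrite -EFinB ltry.
- exact: measurable_funTS.
- have [M hM] := bf a b; exists M; split; first exact: num_real.
  move=> N MN x /=; rewrite in_itv /= => /andP[ax xb].
  apply: le_trans (ltW MN); apply: hM.
  by move: ax xb; case: i; case: j => /= ? ?; apply/andP; split=> //; apply/ltW.
Qed.

Lemma locally_integrable_cst k : locally_integrable (fun=> k).
Proof. by split => // a b; exists `|k|. Qed.

Lemma locally_integrableD f g : locally_integrable f -> locally_integrable g ->
  locally_integrable (fun x => f x + g x).
Proof.
move=> [mf bf] [mg bg]; split; first exact: measurable_funD.
move=> a b; have [M hM] := bf a b; have [N hN] := bg a b.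
by exists (M + N) => x xab; rewrite (le_trans (ler_normD _ _)) // lerD ?hM ?hN.
Qed.

Lemma locally_integrableZ k f : locally_integrable f -> locally_integrable (fun x => k * f x).
Proof.
move=> [mf bf]; split; first exact: measurable_funM.
move=> a b; have [M hM] := bf a b.
by exists (`|k| * M) => x xab; rewrite normrM ler_wpM2l ?hM.
Qed.

Lemma locally_integrableB f g : locally_integrable f -> locally_integrable g ->
  locally_integrable (fun x => f x - g x).
Proof.
move=> lf lg; have := locally_integrableD lf (locally_integrableZ (-1) lg).
by under eq_fun do rewrite mulN1r.
Qed.

Lemma locally_integrable_norm f : locally_integrable f -> locally_integrable (fun x => `|f x|).
Proof.
move=> [mf bf]; split; first exact: measurableT_comp.
by move=> a b; have [M hM] := bf a b; exists M => x /hM; rewrite normr_id.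
Qed.

Lemma locally_integrable_sum (I : Type) (s : seq I) (F : I -> R -> R) :
  (forall i, locally_integrable (F i)) -> locally_integrable (fun x => \sum_(i <- s) F i x).
Proof.
move=> lF; elim: s => [|i s IH].
  by under eq_fun do rewrite big_nil; exact: locally_integrable_cst.
by under eq_fun do rewrite big_cons; exact: locally_integrableD.
Qed.

Lemma locally_integrable_shift u f : locally_integrable f ->
  locally_integrable (fun x => f (x + u)).
Proof.
move=> [mf bf]; split.
  by apply: (measurableT_comp mf); exact: measurable_funD.
move=> a b; have [M hM] := bf (a + u) (b + u).
by exists M => x xab; apply: hM; lra.
Qed.

Lemma locally_integrable_floor : locally_integrable (fun x => (Num.floor x)%:~R).
Proof.
split.
  by apply: nondecreasing_measurable => // x y xy; rewrite ler_int le_floor.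
move=> a b; exists (`|a| + `|b| + 1) => x /andP[ax xb].
have := floor_le x; have := floorD1_gt x; rewrite intrD.
have := ler_norm b; have := ler_norm (- a); rewrite normrN => ? ? ? ?.
by rewrite ler_norml; have := normr_ge0 a; have := normr_ge0 b => ? ?; lra.
Qed.

Lemma itv_integral_split f a b c : locally_integrable f -> a <= b <= c ->
  itv_integral f a c = itv_integral f a b + itv_integral f b c.
Proof.
move=> lf /andP[ab bc]; rewrite /itv_integral (@itv_bndbnd_setU _ _ _ (BLeft b)) ?bnd_simp //.
rewrite Rintegral_setU //.
- rewrite -itv_bndbnd_setU ?bnd_simp //; exact: locally_integrable_itv.
- apply/disj_setPS => x [] /=; rewrite !in_itv /= => /andP[_ xb] /andP[bx _].
  by rewrite ltNge bx in xb.
Qed.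

Lemma itv_integral_cst f a b k : a <= b -> (forall x, a <= x < b -> f x = k) ->
  itv_integral f a b = k * (b - a).
Proof.
move=> ab fk; rewrite /itv_integral.
rewrite (@eq_Rintegral _ _ _ _ _ (fun=> k)); last first.
  by move=> x; rewrite inE /= in_itv /= => /fk.
rewrite Rintegral_cst //; congr (_ * _); rewrite /= lebesgue_measure_itv /= lte_fin.
have [ab'|ba] := ltP a b; first by rewrite -EFinB.
by rewrite /=; lra.
Qed.

Lemma eq_itv_integral f g a b : (forall x, a <= x < b -> f x = g x) ->
  itv_integral f a b = itv_integral g a b.
Proof.
by move=> fg; apply: eq_Rintegral => x; rewrite inE /= in_itv /= => /fg.
Qed.

Lemma le_itv_integral f g a b : locally_integrable f -> locally_integrable g ->
  (forall x, a <= x < b -> f x <= g x) -> itv_integral f a b <= itv_integral g a b.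
Proof.
move=> lf lg fg; apply: le_Rintegral => //; try exact: locally_integrable_itv.
Qed.

(** The image measure agrees with Lebesgue measure on the intervals ]x, y], which determine it. *)
Lemma lebesgue_measure_shift u (A : set R) : measurable A ->
  mu A = pushforward mu (fun x : measurableTypeR R => x + u : measurableTypeR R) A.
Proof.
have mu_u : measurable_fun setT (fun x : measurableTypeR R => x + u : measurableTypeR R).
  exact: measurable_funD.
pose nu := pushforward mu (fun x : measurableTypeR R => x + u : measurableTypeR R).
move=> mA; apply: (@lebesgue_measure_unique R nu) => // X [[x y] _ <-] /=.
rewrite /nu /pushforward.
have -> : (fun x : R => x + u) @^-1` `]x, y] = `]x - u, y - u].
  by apply/seteqP; split => z /=; rewrite !in_itv /= => /andP[? ?]; apply/andP; split; lra.
rewrite !lebesgue_measure_itv /= !lte_fin ltrD2r; case: ifP => // _.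
by rewrite -!EFinB; congr EFin; ring.
Qed.

Lemma itv_integral_shift f u a b : locally_integrable f ->
  itv_integral (fun x => f (x + u)) a b = itv_integral f (a + u) (b + u).
Proof.
move=> lf; rewrite /itv_integral /Rintegral; congr fine.
have mu_u : measurable_fun setT (fun x : measurableTypeR R => x + u : measurableTypeR R).
  exact: measurable_funD.
have pre : (fun x : R => x + u) @^-1` `[a + u, b + u[ = `[a, b[.
  by apply/seteqP; split => z /=; rewrite !in_itv /= => /andP[? ?]; apply/andP; split; lra.
rewrite [RHS](eq_measure_integral (pushforward mu
  (fun x : measurableTypeR R => x + u : measurableTypeR R))); last first.
  by move=> A mA _; exact: lebesgue_measure_shift.
rewrite integral_pushforward //=.
- by congr (integral _ _ _); exact/esym/pre.
- by apply/measurable_EFinP; case: lf.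
- rewrite [X in integrable _ X _](pre); apply: locally_integrable_itv; exact: locally_integrable_shift.
Qed.

(** For a in [0, 1] the interval is cut at 1 and its second part moved back by 1; the integer part
    of a general a is removed by translation. *)
Lemma itv_integral_period f a : locally_integrable f -> (forall x, f (x + 1) = f x) ->
  itv_integral f a (a + 1) = itv_integral f 0 1.
Proof.
move=> lf f1.
have small b : 0 <= b <= 1 -> itv_integral f b (b + 1) = itv_integral f 0 1.
  move=> b01; rewrite (@itv_integral_split _ b 1 (b + 1)) //; last by lra.
  rewrite (@itv_integral_split _ 0 b 1) // addrC; congr (_ + _).
  have := itv_integral_shift 1 0 b lf; rewrite add0r => <-.
  by apply: eq_itv_integral.
have perN (n : nat) x : f (x + n%:R) = f x.
  by elim: n => [|n IH]; rewrite ?addr0 // -natr1 addrA f1.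
have perZ (z : int) x : f (x + z%:~R) = f x.
  case: z => n; first by rewrite -pmulrn perN.
  by rewrite NegzE mulrNz -pmulrn -[in RHS](subrK n.+1%:R x) perN.
have := floor_le a; have := floorD1_gt a; rewrite intrD => h1 h2.
rewrite -(small (a - (Num.floor a)%:~R)); last by lra.
have -> : a - (Num.floor a)%:~R + 1 = (a + 1) + - (Num.floor a)%:~R by ring.
rewrite -itv_integral_shift //; apply: eq_itv_integral => x _.
by rewrite -mulrNz perZ.
Qed.

End IntervalIntegral.

Section FractionalPart.
Variable R : realType.
Implicit Types x y : R.

Definition fracpart x : R := x - (Num.floor x)%:~R.

Lemma fracpart_range x : 0 <= fracpart x < 1.
Proof.
rewrite /fracpart; have := floor_le x; have := floorD1_gt x.
by rewrite intrD => ? ?; lra.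
Qed.

Lemma floor_eqP x (n : int) : n%:~R <= x < n%:~R + 1 -> Num.floor x = n.
Proof. by move=> nx; apply/eqP; rewrite floor_eq intrD. Qed.

Lemma floorDz x (n : int) : Num.floor (x + n%:~R) = Num.floor x + n.
Proof. by rewrite floorDrz ?intr_int // intrKfloor. Qed.

Lemma fracpartDz x (n : int) : fracpart (x + n%:~R) = fracpart x.
Proof. by rewrite /fracpart floorDz intrD; ring. Qed.

Lemma fracpart_id x : 0 <= x < 1 -> fracpart x = x.
Proof.
by move=> x01; rewrite /fracpart (@floor_eqP x 0) ?subr0 // add0r.
Qed.

Lemma fracparted x : x = fracpart x + (Num.floor x)%:~R.
Proof. by rewrite /fracpart subrK. Qed.

End FractionalPart.

Section ItvIntegralLinear.
Variable R : realType.
Implicit Types (f g : R -> R).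

Lemma itv_integralD f g a b : locally_integrable f -> locally_integrable g ->
  itv_integral (fun x => f x + g x) a b = itv_integral f a b + itv_integral g a b.
Proof. by move=> lf lg; apply: RintegralD => //; exact: locally_integrable_itv. Qed.

Lemma itv_integralZ k f a b : locally_integrable f ->
  itv_integral (fun x => k * f x) a b = k * itv_integral f a b.
Proof. by move=> lf; apply: RintegralZl => //; exact: locally_integrable_itv. Qed.

Lemma itv_integral_sum_arcs f (c : nat -> R) n : locally_integrable f ->
  (forall k, c k <= c k.+1) ->
  itv_integral f (c 0%N) (c n) = \sum_(k < n) itv_integral f (c k) (c k.+1).
Proof.
move=> lf cS; have c0 k : c 0%N <= c k by elim: k => // k h; exact: le_trans h (cS k).
elim: n => [|n IH]; last by rewrite (@itv_integral_split _ _ _ (c n)) ?c0 ?cS // big_ord_recr IH.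
by rewrite big_ord0 (@itv_integral_cst _ _ _ _ (f (c 0%N))) ?subrr ?mulr0 // => x; lra.
Qed.

Lemma exists_min (I : finType) (i0 : I) (F : I -> R) : exists i, forall j, F i <= F j.
Proof.
have [i _ h] := @Order.TotalTheory.arg_minP _ _ _ i0 xpredT F isT.
by exists i => j; apply: h.
Qed.

End ItvIntegralLinear.

(* A quasi-periodic step function that jumps by [w k] at the points
   [beta k + z], z an integer; on [0, 2] this is the 2 pi-extension of a
   turning function. *)
Section StepFunction.
Variables (R : realType) (m : nat) (w beta : nat -> R) (t0 : R).

(** For [beta k] in (0, 1] the last factor is 0 at x = 0 and becomes 1 at [beta k]; then [t0] is the
    value at 0, and each jump is counted at most once on [0, 1]. *)
Definition step_fun (x : R) : R :=
  t0 + \sum_(k < m) w k * ((Num.floor (x - beta k))%:~R + 1).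

Definition total_jump : R := \sum_(k < m) w k.

Lemma step_fun_locally_integrable : locally_integrable step_fun.
Proof.
apply: locally_integrableD; first exact: locally_integrable_cst.
apply: locally_integrable_sum => k; apply: locally_integrableZ.
apply: locally_integrableD; last exact: locally_integrable_cst.
exact: (locally_integrable_shift (- beta k) (locally_integrable_floor R)).
Qed.

Lemma step_funDz x (z : int) : step_fun (x + z%:~R) = step_fun x + z%:~R * total_jump.
Proof.
rewrite /step_fun /total_jump -addrA; congr (_ + _).
rewrite mulr_sumr -big_split /=; apply: eq_bigr => k _.
by rewrite addrAC floorDz intrD; ring.
Qed.

Lemma step_funD1 x : step_fun (x + 1) = step_fun x + total_jump.
Proof. by have := step_funDz x 1; rewrite mul1r. Qed.

Lemma eq_step_fun x y :
  (forall k, (k < m)%N -> Num.floor (x - beta k) = Num.floor (y - beta k)) ->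
  step_fun x = step_fun y.
Proof.
by move=> xy; congr (_ + _); apply: eq_bigr => k _; rewrite xy.
Qed.

(** Going back from x + beta a, the first jump met is the one that minimizes the fractional part of
    the distance. It lies in the period that starts at [beta a], since [beta a] is itself a
    candidate. *)
Lemma step_fun_last_jump a x : (a < m)%N -> 0 <= x < 1 ->
  exists2 b, (b < m)%N & step_fun (x + beta a) = step_fun (beta a + fracpart (beta b - beta a)).
Proof.
move=> am x01; have [b bmin] := exists_min (Ordinal am) (fun b : 'I_m => fracpart (x + beta a - beta b)).
exists b => //; set f := fracpart (x + beta a - beta b) in bmin.
have fr k : 0 <= fracpart (x + beta a - beta k) < 1 by exact: fracpart_range.
have fa : f <= x.
  by have := bmin (Ordinal am); rewrite /= addrK (fracpart_id x01).
have yE : fracpart (beta b - beta a) = x - f.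
  rewrite -[RHS]fracpart_id; last by have := fr b; rewrite -/f => ?; lra.
  have -> : x - f = (beta b - beta a) + (Num.floor (x + beta a - beta b))%:~R.
    by rewrite /f /fracpart; ring.
  by rewrite fracpartDz.
rewrite yE; apply: eq_step_fun => k kn; apply/esym/floor_eqP.
have := bmin (Ordinal kn); rewrite /= => fk; have := fr k; have := fr b.
have := fracparted (x + beta a - beta k); rewrite -/f => ? ? ?; lra.
Qed.

(** Within less than a period each k jumps at most once, so the difference is the sum of [w] over
    the set S of jumps passed. If S has at most m / 2 + 1 elements, its own sum is bounded;
    otherwise the difference is the total jump, at most 2 B, minus the few jumps outside S. This is
    the origin of the floor in [lambda]. *)
Lemma step_fun_diff (B : R) x y : (forall k, (k < m)%N -> `|w k| <= B) ->
  `|total_jump| <= 2 * B -> x <= y < x + 1 ->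
  `|step_fun y - step_fun x| <= (m./2).+1%:R * B.
Proof.
move=> wB tB xy; have B0 : 0 <= B by have := normr_ge0 total_jump; lra.
pose S := [pred k : 'I_m | Num.floor (y - beta k) != Num.floor (x - beta k)].
have dE : step_fun y - step_fun x = \sum_(k < m | S k) w k.
  rewrite /step_fun opprD addrACA subrr add0r -sumrB [RHS]big_mkcond /=.
  apply: eq_bigr => k _; rewrite /S /=; case: eqVneq => [->|ne]; first by rewrite subrr.
  rewrite -mulrBr opprD addrACA subrr addr0 -intrB.
  suff -> : Num.floor (y - beta k) = Num.floor (x - beta k) + 1.
    by rewrite addrAC subrr add0r mulr1.
  have h1 : Num.floor (x - beta k) <= Num.floor (y - beta k) by apply: le_floor; lra.
  have h2 : Num.floor (y - beta k) <= Num.floor (x - beta k + 1%:~R) by apply: le_floor; lra.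
  rewrite floorDz in h2; move: ne h1 h2; lia.
have sumB (p : pred 'I_m) : `|\sum_(k < m | p k) w k| <= #|p|%:R * B.
  rewrite (le_trans (ler_norm_sum _ _ _)) // -sum1_card natr_sum mulr_suml.
  by apply: ler_sum => k _; rewrite mul1r wB.
have [small|large] := leqP #|S| (m./2).+1.
  rewrite dE (le_trans (sumB _)) // ler_wpM2r // ler_nat; exact: small.
have tE : total_jump = \sum_(k < m | S k) w k + \sum_(k < m | ~~ S k) w k.
  by rewrite /total_jump (bigID S).
have -> : step_fun y - step_fun x = total_jump - \sum_(k < m | ~~ S k) w k.
  by rewrite tE addrK dE.
rewrite (le_trans (ler_normB _ _)) // (le_trans (lerD tB (sumB _))) // -mulrDl.
rewrite ler_wpM2r // -natrD ler_nat.
have -> : #|[pred k | ~~ S k]| = #|[predC S]| by [].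
move: large; have := cardC S; rewrite card_ord; move: #|S| #|[predC S]| => a b.
by lia.
Qed.

Hypothesis m0 : (0 < m)%N.
Hypothesis betaS : forall k, beta k <= beta k.+1.
Hypothesis betaD : forall k, beta (k + m)%N = beta k + 1.

Lemma beta_homo i j : (i <= j)%N -> beta i <= beta j.
Proof.
elim: j => [|j IH]; first by rewrite leqn0 => /eqP ->.
by rewrite leq_eqVlt => /predU1P[->//|/IH h]; exact: le_trans h (betaS j).
Qed.

Lemma step_fun_arc k x : (k < m)%N -> beta k <= x < beta k.+1 -> step_fun x = step_fun (beta k).
Proof.
move=> km /andP[kx xk]; apply: eq_step_fun => j jm.
have [jk|kj] := leqP j k.
  have h1 := beta_homo jk.
  have h2 : beta k.+1 <= beta j + 1.
    by rewrite -betaD; apply: beta_homo; lia.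
  by rewrite !(@floor_eqP _ _ 0) //; lra.
have h1 := beta_homo kj.
have h2 : beta j <= beta k + 1.
  by rewrite -betaD; apply: beta_homo; lia.
rewrite (@floor_eqP _ (x - _) (-1)) ?(@floor_eqP _ (_ - _) (-1)) //; lra.
Qed.

End StepFunction.

(** * Shifts that align two jumps *)

Section CriticalAlignment.
Variables (R : realType) (m : nat) (w beta : nat -> R) (t0 : R).
Variables (m' : nat) (w' beta' : nat -> R) (t0' : R).
Local Notation T := (step_fun m w beta t0).
Local Notation T' := (step_fun m' w' beta' t0').
Hypothesis m0 : (0 < m)%N.
Hypothesis m0' : (0 < m')%N.
Hypothesis betaS : forall k, beta k <= beta k.+1.
Hypothesis betaD : forall k, beta (k + m)%N = beta k + 1.
Hypothesis same_jump : total_jump m w = total_jump m' w'.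
Implicit Types (alpha u x z : R).

Definition shift_dist alpha u : R :=
  itv_integral (fun x => `|T (x + u) + alpha - T' x|) 0 1.

Lemma shift_dist_integrand alpha u :
  locally_integrable (fun x => `|T (x + u) + alpha - T' x|).
Proof.
apply: locally_integrable_norm; apply: locally_integrableB.
  apply: locally_integrableD; last exact: locally_integrable_cst.
  exact/locally_integrable_shift/step_fun_locally_integrable.
exact: step_fun_locally_integrable.
Qed.

Lemma shift_dist_integrand1 alpha u x :
  `|T (x + 1 + u) + alpha - T' (x + 1)| = `|T (x + u) + alpha - T' x|.
Proof. by rewrite [x + 1 + u]addrAC !step_funD1 same_jump; congr (Num.norm _); ring. Qed.

Lemma shift_distDz alpha u (z : int) :
  shift_dist alpha (u + z%:~R) = shift_dist (alpha + z%:~R * total_jump m w) u.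
Proof.
apply: eq_itv_integral => x _; rewrite addrA step_funDz.
by congr (Num.norm _); ring.
Qed.

(** The period of integration is moved to start at [beta 0 - u]. Then T is constant on each arc, and
    u enters only through the ends of the arcs. *)
Lemma shift_dist_arcs alpha u : shift_dist alpha u = \sum_(k < m)
  itv_integral (fun x => `|T (beta k) + alpha - T' x|) (beta k - u) (beta k.+1 - u).
Proof.
rewrite /shift_dist -(itv_integral_period (beta 0%N - u) (shift_dist_integrand alpha u)); last first.
  exact: shift_dist_integrand1.
have -> : beta 0%N - u + 1 = beta m - u by rewrite -[m]add0n betaD; ring.
rewrite (itv_integral_sum_arcs (c := fun k => beta k - u)); [|exact: shift_dist_integrand|]; last first.
  by move=> k; have := betaS k; lra.
apply: eq_bigr => k _; apply: eq_itv_integral => x xk.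
by rewrite (step_fun_arc _ _ m0 betaS betaD (ltn_ord k)) //; lra.
Qed.

Lemma shift_dist_critical_shift alpha u : exists k l (z : int),
  [/\ (k < m)%N, (l < m')%N &
      shift_dist alpha (beta k - beta' l + z%:~R) <= shift_dist alpha u].
Proof.
pose r (i : 'I_m * 'I_m') := beta i.1 - beta' i.2.
pose i0 : 'I_m * 'I_m' := (Ordinal m0, Ordinal m0').
have [i1 min1] := exists_min i0 (fun i => fracpart (u - r i)).
have [i2 min2] := exists_min i0 (fun i => - fracpart (u - r i)).
(* [c1] and [c2] are the aligned shifts next to u; in between, [shift_dist] is affine. *)
pose c1 := r i1 + (Num.floor (u - r i1))%:~R.
pose c2 := r i2 + (Num.floor (u - r i2) + 1)%:~R.
have c1E : c1 = u - fracpart (u - r i1) by rewrite /c1 /fracpart; ring.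
have c2E : c2 = u + 1 - fracpart (u - r i2) by rewrite /c2 /fracpart intrD; ring.
have c1u : c1 <= u by have := fracpart_range (u - r i1); lra.
have uc2 : u < c2 by have := fracpart_range (u - r i2); lra.
(* [T'] does not jump where the arc end [beta k - z] moves, as no aligned shift lies strictly
   between [c1] and [c2]. The index k = m is the end of the last arc, a copy of jump 0. *)
have constT' (k : nat) x : (k <= m)%N -> beta k - c2 <= x < beta k - c1 ->
    T' x = T' (beta k - c2).
  move=> km xk; apply: eq_step_fun => l lm'.
  have [k' [e ek]] : exists (k' : 'I_m) (e : int), beta k = beta k' + e%:~R.
    move: km; rewrite leq_eqVlt => /predU1P[->|km].
      by exists (Ordinal m0), 1; have := betaD 0%N; rewrite add0n.
    by exists (Ordinal km), 0; rewrite addr0.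
  pose i := (k', Ordinal lm').
  have := min1 i; have := min2 i; have := fracparted (u - r i).
  set f := fracpart (u - r i); set F := Num.floor (u - r i).
  rewrite {1}/r /= => e1 h2 h1.
  have bnd y : beta k - c2 <= y < beta k - c1 -> Num.floor (y - beta' l) = e - F - 1.
    by move=> yk; apply: floor_eqP; rewrite !intrD mulrNz; lra.
  by rewrite !bnd //; lra.
pose tau k := T' (beta k - c2).
pose h k x := `|T (beta k) + alpha - T' x|.
have lh k : locally_integrable (h k).
  apply/locally_integrable_norm/locally_integrableB; first exact: locally_integrable_cst.
  exact: step_fun_locally_integrable.
(* The slope: when the shift decreases, each arc gains length at its right end, where [T'] is
   [tau k.+1], and loses it at its left end, where [T'] is [tau k]. *)
pose s := \sum_(k < m) (`|T (beta k) + alpha - tau k.+1| - `|T (beta k) + alpha - tau k|).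
have affine z : c1 <= z <= c2 -> shift_dist alpha z = shift_dist alpha c2 + (c2 - z) * s.
  move=> zc; rewrite !shift_dist_arcs mulr_sumr -big_split /=.
  apply: eq_bigr => k _; rewrite -/(h k).
  have bS := betaS k; have km := ltn_ord k.
  have e1 : itv_integral (h k) (beta k - c2) (beta k.+1 - z) =
    itv_integral (h k) (beta k - c2) (beta k - z)
    + itv_integral (h k) (beta k - z) (beta k.+1 - z).
    by apply: itv_integral_split => //; lra.
  have e2 : itv_integral (h k) (beta k - c2) (beta k.+1 - z) =
    itv_integral (h k) (beta k - c2) (beta k.+1 - c2)
    + itv_integral (h k) (beta k.+1 - c2) (beta k.+1 - z).
    by apply: itv_integral_split => //; lra.
  have e3 : itv_integral (h k) (beta k - c2) (beta k - z) =
      `|T (beta k) + alpha - tau k| * (beta k - z - (beta k - c2)).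
    apply: itv_integral_cst => [|x xk]; first by lra.
    by rewrite /h (constT' k) //; [exact: ltnW|lra].
  have e4 : itv_integral (h k) (beta k.+1 - c2) (beta k.+1 - z) =
      `|T (beta k) + alpha - tau k.+1| * (beta k.+1 - z - (beta k.+1 - c2)).
    apply: itv_integral_cst => [|x xk]; first by lra.
    by rewrite /h (constT' k.+1) //; lra.
  move: e1; rewrite e2 e3 e4 => e1.
  have -> : itv_integral (h k) (beta k - z) (beta k.+1 - z) =
    itv_integral (h k) (beta k - c2) (beta k.+1 - c2)
    + `|T (beta k) + alpha - tau k.+1| * (beta k.+1 - z - (beta k.+1 - c2))
    - `|T (beta k) + alpha - tau k| * (beta k - z - (beta k - c2)).
    by rewrite e1; ring.
  by ring.
have [s0|s0] := leP s 0.
  exists i1.1, i1.2, (Num.floor (u - r i1)); split => //; rewrite -/(r i1) -/c1.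
  rewrite (affine c1) ?(affine u); [|lra..].
  by rewrite lerD2l -subr_ge0 -mulrBl; apply: mulr_le0; lra.
exists i2.1, i2.2, (Num.floor (u - r i2) + 1); split => //; rewrite -/(r i2) -/c2.
by rewrite (affine u) ?lerDl ?mulr_ge0 //; lra.
Qed.

End CriticalAlignment.

(* A weighted median of the values of G minimizes the integral of |G + alpha|. *)
Lemma exists_median (R : realType) (I : finType) (i0 : I) (V : I -> R) (G : R -> R) (alpha : R) :
  locally_integrable G -> (forall x, 0 <= x < 1 -> exists i, G x = V i) ->
  exists i, itv_integral (fun x => `|G x - V i|) 0 1 <= itv_integral (fun x => `|G x + alpha|) 0 1.
Proof.
move=> lG GV.
have lB k : locally_integrable (fun x => `|G x - k|).
  exact/locally_integrable_norm/locally_integrableB/locally_integrable_cst.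
have lD : locally_integrable (fun x => `|G x + alpha|).
  exact/locally_integrable_norm/locally_integrableD/locally_integrable_cst.
(* If all values lie on one side of [- alpha], the value nearest to [- alpha] is at least as
   good. *)
have [[il ilP]|no_lo] := pselect (exists i, V i <= - alpha); last first.
  have [i imin] := exists_min i0 V; exists i.
  apply: le_itv_integral => // x /GV[j ->].
  have vj : - alpha < V j by rewrite ltNge; apply/negP => h; apply: no_lo; exists j.
  have vi : - alpha < V i by rewrite ltNge; apply/negP => h; apply: no_lo; exists i.
  by have := imin j => ?; rewrite !ger0_norm; lra.
have [[iu iuP]|no_up] := pselect (exists i, - alpha <= V i); last first.
  have [i imax] := exists_min i0 (fun i => - V i); exists i.
  apply: le_itv_integral => // x /GV[j ->].
  have vj : V j < - alpha by rewrite ltNge; apply/negP => h; apply: no_up; exists j.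
  have vi : V i < - alpha by rewrite ltNge; apply/negP => h; apply: no_up; exists i.
  by have := imax j => ?; rewrite !ler0_norm; lra.
have [lo loP lomax] := @Order.TotalTheory.arg_maxP _ _ _ il (fun i => V i <= - alpha) V ilP.
have [up upP upmin] := @Order.TotalTheory.arg_minP _ _ _ iu (fun i => - alpha <= V i) V iuP.
have [e|ne] := eqVneq (V lo) (V up).
  exists lo; rewrite (_ : V lo = - alpha); last by lra.
  by under eq_fun do rewrite opprK.
(* No value of G lies strictly between [V lo] and [V up], so the integral is affine in the
   subtracted constant there, and one of the two ends is no worse than [- alpha]. *)
have cvx : (V up - V lo) * itv_integral (fun x => `|G x + alpha|) 0 1 =
   (V up + alpha) * itv_integral (fun x => `|G x - V lo|) 0 1
   + (- alpha - V lo) * itv_integral (fun x => `|G x - V up|) 0 1.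
  rewrite -!itv_integralZ // -itv_integralD; try exact: locally_integrableZ.
  apply: eq_itv_integral => x /GV[j ->].
  have [h|h] := leP (V j) (- alpha).
    by have := lomax j h => /= ?; rewrite !ler0_norm; [ring|lra..].
  by have := upmin j (ltW h) => /= ?; rewrite !ger0_norm; [ring|lra..].
have lu : V lo < V up by rewrite lt_neqAle ne; lra.
have [h1|h1] := leP (itv_integral (fun x => `|G x - V lo|) 0 1) (itv_integral (fun x => `|G x + alpha|) 0 1).
  by exists lo.
exists up; rewrite leNgt; apply/negP => h2.
move: cvx h1 h2; move: (itv_integral _ 0 1) (itv_integral _ 0 1) (itv_integral _ 0 1).
move=> C B A cvx h1 h2.
have : (V up + alpha) * (B - A) + (- alpha - V lo) * (C - A) = 0.
  by transitivity ((V up + alpha) * B + (- alpha - V lo) * C - (V up - V lo) * A);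
    [ring|rewrite -cvx subrr].
have p1 : 0 <= (V up + alpha) * (B - A) by apply: mulr_ge0; lra.
have p2 : 0 <= (- alpha - V lo) * (C - A) by apply: mulr_ge0; lra.
move=> e0.
have /eqP : (V up + alpha) * (B - A) = 0 by lra.
have /eqP : (- alpha - V lo) * (C - A) = 0 by lra.
by rewrite !mulf_eq0 => /orP[/eqP ?|/eqP ?] /orP[/eqP ?|/eqP ?]; lra.
Qed.

(** * Canonical step functions *)

Section CanonicalFunctions.
Variable R : realType.

(* The fractional part selects the copy of the jump point [b] in the period that
   starts at the jump point [a]. *)
Definition canonical (m : nat) (w beta : nat -> R) (t0 : R) (a b : nat) (x : R) : R :=
  let T := step_fun m w beta t0 in
  T (x + beta a) - T (beta a + fracpart (beta b - beta a)).

Lemma canonical_integrable m w beta t0 a b : locally_integrable (canonical m w beta t0 a b).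
Proof.
apply: locally_integrableB; last exact: locally_integrable_cst.
exact/locally_integrable_shift/step_fun_locally_integrable.
Qed.

Lemma canonical_bound m w beta t0 a b (B : R) x : (forall k, (k < m)%N -> `|w k| <= B) ->
  `|total_jump m w| <= 2 * B -> 0 <= x < 1 ->
  `|canonical m w beta t0 a b x| <= (m./2).+1%:R * B.
Proof.
move=> wB tB x1; rewrite /canonical.
have f1 := fracpart_range (beta b - beta a).
have [h|h] := leP (fracpart (beta b - beta a)) x.
  by apply: step_fun_diff => //; lra.
by rewrite distrC; apply: step_fun_diff => //; lra.
Qed.

Variables (m : nat) (w beta : nat -> R) (t0 : R).
Variables (m' : nat) (w' beta' : nat -> R) (t0' : R).
Local Notation T := (step_fun m w beta t0).
Local Notation T' := (step_fun m' w' beta' t0').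
Hypothesis m0 : (0 < m)%N.
Hypothesis m0' : (0 < m')%N.
Hypothesis betaS : forall k, beta k <= beta k.+1.
Hypothesis betaD : forall k, beta (k + m)%N = beta k + 1.
Hypothesis same_jump : total_jump m w = total_jump m' w'.
Local Notation Phi := (shift_dist m w beta t0 m' w' beta' t0').

Definition canonical_dist a b a' b' : R :=
  itv_integral (fun x => `|canonical m w beta t0 a b x - canonical m' w' beta' t0' a' b' x|) 0 1.

Lemma shift_dist_aligned alpha a a' : Phi alpha (beta a - beta' a') =
  itv_integral (fun x => `|T (x + beta a) - T' (x + beta' a') + alpha|) 0 1.
Proof.
have lf := shift_dist_integrand m w beta t0 m' w' beta' t0' alpha (beta a - beta' a').
rewrite /shift_dist -(itv_integral_period (beta' a') lf); last first.
  by move=> x; exact: shift_dist_integrand1.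
have := itv_integral_shift (beta' a') 0 1 lf; rewrite add0r (addrC 1) => <-.
apply: eq_itv_integral => x _; congr (Num.norm _).
have -> : x + beta' a' + (beta a - beta' a') = x + beta a by ring.
by ring.
Qed.

Lemma canonical_distE a b a' b' : canonical_dist a b a' b' =
  Phi (T' (beta' a' + fracpart (beta' b' - beta' a')) - T (beta a + fracpart (beta b - beta a)))
      (beta a - beta' a').
Proof.
rewrite shift_dist_aligned; apply: eq_itv_integral => x _.
by rewrite /canonical; congr (Num.norm _); ring.
Qed.

(** The aligned shift selects a and a'. Every value of T - T' is determined by the last jumps b of T
    and b' of T', and so is the median; subtracting it amounts to making each function 0 at its own
    jump. *)
Lemma exists_canonical_le alpha u : exists a b a' b',
  [/\ (a < m)%N, (b < m)%N, (a' < m')%N, (b' < m')%N &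
      canonical_dist a b a' b' <= Phi alpha u].
Proof.
have [a [a' [z [am am' hz]]]] :=
  @shift_dist_critical_shift R m w beta t0 m' w' beta' t0' m0 m0' betaS betaD same_jump alpha u.
(* The integer part of the shift becomes part of the offset. *)
rewrite shift_distDz shift_dist_aligned in hz.
set al := alpha + _ in hz.
pose V (i : 'I_m * 'I_m') := T (beta a + fracpart (beta i.1 - beta a))
   - T' (beta' a' + fracpart (beta' i.2 - beta' a')).
pose G x := T (x + beta a) - T' (x + beta' a').
have lG : locally_integrable G.
  by apply: locally_integrableB; exact/locally_integrable_shift/step_fun_locally_integrable.
have GV x : 0 <= x < 1 -> exists i, G x = V i.
  move=> x1; have [b bm eb] := @step_fun_last_jump R m w beta t0 _ _ am x1.
  have [b' bm' eb'] := @step_fun_last_jump R m' w' beta' t0' _ _ am' x1.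
  by exists (Ordinal bm, Ordinal bm'); rewrite /G eb eb'.
have [[b b'] hb] := exists_median (Ordinal m0, Ordinal m0') al lG GV.
exists a, b, a', b'; split => //; apply: le_trans hz; apply: le_trans hb.
rewrite le_eqVlt; apply/orP; left; apply/eqP/eq_itv_integral => x _.
by rewrite /canonical /G /V /=; congr (Num.norm _); ring.
Qed.

End CanonicalFunctions.

(** * Turning functions *)

Section PolygonStepFunction.
Variables (R : realType) (P : polygon R).
Local Notation vs := (verts P).
Local Notation m := (size vs).

Definition turn_at (k : nat) : R := turning (edge vs k) (edge vs k.+1).

(* Normalized arc length, measured from the reference point, of vertex [k.+1]. *)
Definition vertex_position (k : nat) : R :=
  (boundary_length P k.+1 - origin P * boundary_length P 1) / perimeter P.

Definition polygon_step : R -> R :=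
  step_fun m turn_at vertex_position (direction (edge vs 0)).

Definition polygon_canonical (a b : nat) : R -> R :=
  canonical m turn_at vertex_position (direction (edge vs 0)) a b.

Lemma polygon_size_gt0 : (0 < m)%N.
Proof. exact: leq_trans (polygon_size P). Qed.

Lemma edge_norm_gt0 k : 0 < norm2 (edge vs k).
Proof.
rewrite norm2_gt0; apply/eqP => e0; have := @polygon_corners R P k.
by rewrite e0 /cross /= !mul0r subrr eqxx.
Qed.

Lemma boundary_lengthS k : boundary_length P k.+1 = boundary_length P k + norm2 (edge vs k).
Proof. by rewrite /boundary_length big_ord_recr. Qed.

Lemma boundary_length_homo i j : (i <= j)%N -> boundary_length P i <= boundary_length P j.
Proof.
elim: j => [|j IH]; first by rewrite leqn0 => /eqP ->.
rewrite leq_eqVlt => /predU1P[->//|/IH h].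
by rewrite boundary_lengthS (le_trans h) // lerDl ltW ?edge_norm_gt0.
Qed.

Lemma boundary_length1_gt0 : 0 < boundary_length P 1.
Proof. by rewrite boundary_lengthS /boundary_length big_ord0 add0r edge_norm_gt0. Qed.

Lemma perimeter_gt0 : 0 < perimeter P.
Proof.
by apply: lt_le_trans boundary_length1_gt0 _; apply: boundary_length_homo polygon_size_gt0.
Qed.

Lemma boundary_lengthD k : boundary_length P (k + m) = boundary_length P k + perimeter P.
Proof.
elim: k => [|k IH]; first by rewrite add0n [in RHS]/boundary_length big_ord0 add0r.
by rewrite addSn !boundary_lengthS IH edgeD addrAC.
Qed.

Lemma vertex_positionS k : vertex_position k <= vertex_position k.+1.
Proof.
by rewrite ler_pM2r ?invr_gt0 ?perimeter_gt0 // lerD2r boundary_length_homo.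
Qed.

Lemma vertex_positionD k : vertex_position (k + m) = vertex_position k + 1.
Proof.
rewrite /vertex_position -addSn boundary_lengthD.
by field; rewrite gt_eqF // perimeter_gt0.
Qed.

(** Counting from vertex 1 keeps positions positive, because O lies strictly before vertex 1. Vertex
    0 comes last, as vertex m, with position 1 exactly if O is vertex 0. *)
Lemma vertex_position_range k : (k < m)%N -> 0 < vertex_position k <= 1.
Proof.
move=> km; have p0 := perimeter_gt0; have o1 := origin_range P.
have b1 := boundary_length1_gt0; have h1 := @boundary_length_homo 1 k.+1 isT.
have h2 : boundary_length P k.+1 <= perimeter P := boundary_length_homo km.
apply/andP; split.
  by rewrite divr_gt0 // subr_gt0 (lt_le_trans _ h1) // gtr_pMl //; lra.
rewrite ler_pdivrMr // mul1r (le_trans _ h2) // lerBlDr lerDl mulr_ge0 //; lra.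
Qed.

Lemma turning_functionE x : 0 <= x <= 1 -> turning_function P x = polygon_step x.
Proof.
move=> x1; rewrite /turning_function /polygon_step /step_fun; congr (_ + _).
rewrite big_mkcond /=; apply: eq_bigr => k _; rewrite -/(turn_at k).
have -> : (boundary_length P k.+1 <= arc_position P x) = (vertex_position k <= x).
  by rewrite ler_pdivrMr ?perimeter_gt0 // /arc_position lerBlDl.
have := vertex_position_range (ltn_ord k); case: (leP (vertex_position k) x) => h b.
  by rewrite (@floor_eqP _ _ 0) ?add0r ?mulr1 //; lra.
by rewrite (@floor_eqP _ _ (-1)) ?mulrNz ?addNr ?mulr0 //; lra.
Qed.

Lemma total_jump_polygon : total_jump m turn_at = pi *+ 2.
Proof. exact: polygon_total_turning. Qed.

(** Here the total turning enters: past x = 1 the step function has grown by its total jump, which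
    has to be the 2 pi of the extension. *)
Lemma ext2pi_turning_function x : 0 <= x <= 2 ->
  ext2pi (turning_function P) x = polygon_step x.
Proof.
move=> x2; rewrite /ext2pi; case: ifP => [x1|/negbT]; first by rewrite turning_functionE //; lra.
rewrite -ltNge => x1; rewrite turning_functionE; last by lra.
rewrite -[in RHS](subrK 1 x) /polygon_step step_funD1 total_jump_polygon.
by rewrite mulr_natl.
Qed.

Lemma turn_at_bound k : (k < m)%N -> `|turn_at k| <= pi.
Proof. by move=> _; exact: turning_abs_le. Qed.

Lemma total_jump_bound : `|total_jump m turn_at| <= 2 * pi.
Proof. by rewrite total_jump_polygon mulr2n; have := pi_ge0 R => ?; rewrite ger0_norm; lra. Qed.

Lemma polygon_canonical_integrable a b : locally_integrable (polygon_canonical a b).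
Proof. exact: canonical_integrable. Qed.

Lemma lambda_gt0 n : 0 < lambda R n.
Proof. by rewrite mulr_gt0 ?pi_gt0 // ltr0n addn2. Qed.

(** [pi] bounds every turning angle and half the total turning, so the bound (m / 2 + 1) B holds
    with B = pi. *)
Lemma polygon_canonical_bound n a b x : (m <= n)%N -> 0 <= x < 1 ->
  `|polygon_canonical a b x| <= lambda R n / 2.
Proof.
move=> mn x1; apply: (le_trans (canonical_bound _ _ _ _ turn_at_bound total_jump_bound x1)).
have -> : lambda R n / 2 = (n./2).+1%:R * pi.
  rewrite /lambda (_ : (2 * n./2 + 2 = 2 * (n./2).+1)%N); last by lia.
  by rewrite natrM; field.
by rewrite ler_wpM2r ?pi_ge0 // ler_nat ltnS half_leq.
Qed.

End PolygonStepFunction.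

(** * The D_1 distance as a minimum over canonical functions *)

Section PolygonDistance.
Local Open Scope classical_set_scope.
Variable R : realType.
Implicit Types P Q : polygon R.

Definition polygon_canonical_dist P Q a b a' b' : R :=
  itv_integral (fun x => `|polygon_canonical P a b x - polygon_canonical Q a' b' x|) 0 1.

Let Phi P Q := shift_dist (size (verts P)) (turn_at P) (vertex_position P) (direction (edge (verts P) 0))
   (size (verts Q)) (turn_at Q) (vertex_position Q) (direction (edge (verts Q) 0)).

Lemma D1_integralE P Q alpha u : 0 <= u <= 1 ->
  \int[lebesgue_measure]_(x in `[0, 1])
     `|ext2pi (turning_function P) (x + u) + alpha - turning_function Q x| = Phi P Q alpha u.
Proof.
move=> u1; rewrite /Phi /shift_dist /itv_integral Rintegral_itv_bndo_bndc; last first.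
  exact/locally_integrable_itv/shift_dist_integrand.
apply: eq_Rintegral => x; rewrite inE /= in_itv /= => x1.
by rewrite ext2pi_turning_function ?turning_functionE //; lra.
Qed.

Let same_jump P Q : total_jump (size (verts P)) (turn_at P) = total_jump (size (verts Q)) (turn_at Q).
Proof. by rewrite !total_jump_polygon. Qed.

Lemma D1_le_canonical P Q a b a' b' : D1 P Q <= polygon_canonical_dist P Q a b a' b'.
Proof.
rewrite /polygon_canonical_dist -[leRHS]/(canonical_dist _ _ _ _ _ _ _ _ _ _ _ _).
rewrite canonical_distE; last exact: same_jump.
set u := vertex_position P a - _; set alpha := (X in shift_dist _ _ _ _ _ _ _ _ X _).
(* The infimum only admits shifts in [0, 1]; the integer part of u is traded for a multiple of the
   total jump in the offset. *)
rewrite (fracparted u) shift_distDz.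
have u1 := fracpart_range u.
apply: ge_inf; first by exists 0 => v [al [z [_ ->]]]; apply: Rintegral_ge0.
exists (alpha + (Num.floor u)%:~R * total_jump (size (verts P)) (turn_at P)), (fracpart u).
by split; [lra|rewrite D1_integralE //; lra].
Qed.

Lemma exists_canonical_le_D1 P Q : exists a b a' b',
  [/\ (a < size (verts P))%N, (b < size (verts P))%N,
      (a' < size (verts Q))%N, (b' < size (verts Q))%N &
      polygon_canonical_dist P Q a b a' b' <= D1 P Q].
Proof.
pose I := ('I_(size (verts P)) * 'I_(size (verts P)) * ('I_(size (verts Q)) * 'I_(size (verts Q))))%type.
have mP := polygon_size_gt0 P; have mQ := polygon_size_gt0 Q.
pose i0 : I := ((Ordinal mP, Ordinal mP), (Ordinal mQ, Ordinal mQ)).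
have [[[a b] [a' b']] imin] := exists_min i0
  (fun i : I => polygon_canonical_dist P Q i.1.1 i.1.2 i.2.1 i.2.2).
exists a, b, a', b'; split => //; apply: lb_le_inf.
  exists (Phi P Q 0 0), 0, 0; split; first by rewrite lexx ler01.
  by rewrite D1_integralE // lexx ler01.
move=> v [alpha [u [u1 ->]]]; rewrite D1_integralE //.
have [c [d [c' [d' [cm dm cm' dm' h]]]]] := exists_canonical_le
  (direction (edge (verts P) 0)) (vertex_position Q) (direction (edge (verts Q) 0)) mP mQ
  (vertex_positionS P) (vertex_positionD P) (same_jump P Q) alpha u.
apply: le_trans h.
exact: (imin ((Ordinal cm, Ordinal dm), (Ordinal cm', Ordinal dm'))).
Qed.

(** Settles the case of c r at least lambda + 4 pi, in which no polygon is far from the query. *)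
Lemma D1_le_lambda n P Q : (size (verts P) <= n)%N -> (size (verts Q) <= n)%N ->
  D1 P Q <= lambda R n.
Proof.
move=> Pn Qn; apply: le_trans (D1_le_canonical P Q 0 0 0 0) _.
rewrite -[leRHS]mulr1 -[X in _ * X](subr0 1).
rewrite -(@itv_integral_cst _ (fun=> lambda R n)) //.
apply: le_itv_integral; last 2 first.
- exact: locally_integrable_cst.
- move=> x x1; rewrite (le_trans (ler_normB _ _)) // (splitr (lambda R n)).
  by rewrite lerD // polygon_canonical_bound.
by apply/locally_integrable_norm/locally_integrableB; exact: polygon_canonical_integrable.
Qed.

End PolygonDistance.

(** * Independent hash tables *)

Section ProbabilitySpaces.
Local Open Scope classical_set_scope.
Variable R : realType.

(** Bundling the measure with its space lets powers be formed by recursion on the exponent. *)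
Record prob_space := ProbSpace {
  ps_display : measure_display;
  ps_sort :> measurableType ps_display;
  ps_prob : probability ps_sort R }.

Definition prod_space (S1 S2 : prob_space) : prob_space :=
  @ProbSpace _ (S1 * S2)%type (ps_prob S1 \x ps_prob S2)%E.

Definition unit_space : prob_space := @ProbSpace _ unit (\d_tt)%E.

Fixpoint pow_space (S : prob_space) (n : nat) : prob_space :=
  if n is n'.+1 then prod_space S (pow_space S n') else unit_space.

Fixpoint pow_seq (S : prob_space) (n : nat) : pow_space S n -> seq S :=
  if n is n'.+1 then fun w => w.1 :: pow_seq w.2 else fun=> [::].

Definition pr (S : prob_space) (A : set S) : R := fine (ps_prob S A).

Implicit Types S : prob_space.

Lemma prE S (A : set S) : measurable A -> ps_prob S A = (pr A)%:E.
Proof. by move=> mA; rewrite fineK // fin_num_measure. Qed.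

Lemma pr_ge0 S (A : set S) : 0 <= pr A.
Proof. exact: fine_ge0. Qed.

Lemma pr_le1 S (A : set S) : measurable A -> pr A <= 1.
Proof. by move=> mA; rewrite -lee_fin -prE // probability_le1. Qed.

Lemma pr_setT S : pr [set: S] = 1.
Proof. by rewrite /pr probability_setT. Qed.

Lemma pr_set0 S : pr (@set0 S) = 0.
Proof. by rewrite /pr measure0. Qed.

Lemma pr_le S (A B : set S) : measurable A -> measurable B -> A `<=` B -> pr A <= pr B.
Proof. by move=> mA mB AB; rewrite -lee_fin -!prE // le_measure // inE. Qed.

Lemma pr_setC S (A : set S) : measurable A -> pr (~` A) = 1 - pr A.
Proof.
move=> mA; apply: EFin_inj; rewrite -prE; last exact: measurableC.
by rewrite probability_setC // prE.
Qed.

Lemma pr_setU_le S (A B : set S) : measurable A -> measurable B ->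
  pr (A `|` B) <= pr A + pr B.
Proof.
move=> mA mB; rewrite -lee_fin EFinD -!prE //; last exact: measurableU.
exact: measureU2.
Qed.

Lemma pr_setD_ge S (A B : set S) : measurable A -> measurable B ->
  pr A - pr B <= pr (A `\` B).
Proof.
move=> mA mB; rewrite lerBlDr.
have mD : measurable (A `\` B) by exact: measurableD.
apply: le_trans (pr_setU_le mD mB).
apply: pr_le => //; first exact: measurableU.
by move=> x Ax; have [Bx|nBx] := pselect (B x); [right|left].
Qed.

Lemma pr_setX S1 S2 (A : set S1) (B : set S2) : measurable A -> measurable B ->
  pr (A `*` B : set (prod_space S1 S2)) = pr A * pr B.
Proof.
move=> mA mB; apply: EFin_inj; rewrite -prE; last exact: measurableX.
by rewrite EFinM -!prE //= product_measure1E.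
Qed.

Lemma pr_xsection_le S1 S2 (A : set (prod_space S1 S2)) (p : R) : measurable A -> 0 <= p ->
  (forall x, pr (xsection A x) <= p) -> pr A <= p.
Proof.
move=> mA p0 h; rewrite -lee_fin -prE //=.
have mx x : measurable (xsection A x) by exact: measurable_xsection.
apply: (@le_trans _ _ (\int[ps_prob S1]_x (p%:E))%E).
  apply: ge0_le_integral => //.
  - exact: measurable_fun_xsection.
  - by move=> x _; rewrite /= prE // lee_fin.
by rewrite integral_cst // [X in (_ * X)%E]probability_setT mule1.
Qed.

(** A measurable rectangle; [onth] reads the coordinates without a default element of [S]. *)
Definition pow_event S n (A : nat -> set S) : set (pow_space S n) :=
  [set w | forall i s, onth (pow_seq w) i = Some s -> A i s].

Lemma pow_eventS S n (A : nat -> set S) :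
  pow_event (n := n.+1) A = A 0%N `*` pow_event (n := n) (fun i => A i.+1).
Proof.
apply/seteqP; split => -[s w] /=.
  move=> h; split; first exact: (h 0%N).
  by move=> i; exact: (h i.+1).
by move=> [h0 h] [|i] t /=; [case=> <-|exact: h].
Qed.

Lemma measurable_pow_event S n (A : nat -> set S) : (forall i, measurable (A i)) ->
  measurable (pow_event (n := n) A).
Proof.
elim: n A => [|n IH] A mA; last first.
  by rewrite pow_eventS; apply: measurableX => //; exact: IH.
by rewrite (_ : pow_event _ = setT) //; apply/seteqP; split => // w _ [|i] s.
Qed.

Lemma pr_pow_event S n (A : nat -> set S) : (forall i, measurable (A i)) ->
  pr (pow_event (n := n) A) = \prod_(i < n) pr (A i).
Proof.
elim: n A => [|n IH] A mA.
  rewrite big_ord0 (_ : pow_event _ = setT) ?pr_setT //.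
  by apply/seteqP; split => // w _ [|i] s.
by rewrite pow_eventS pr_setX ?IH ?big_ord_recl //; exact: measurable_pow_event.
Qed.

Definition coord_event S n (i : nat) (A : set S) : set (pow_space S n) :=
  pow_event (n := n) (fun j => if j == i then A else setT).

Lemma coord_eventP S n i (A : set S) (w : pow_space S n) :
  coord_event i A w <-> forall s, onth (pow_seq w) i = Some s -> A s.
Proof.
split=> [h s|h j s]; first by move=> /h; rewrite eqxx.
by case: eqP => // -> /h.
Qed.

Lemma measurable_coord_event S n i (A : set S) : measurable A ->
  measurable (coord_event (n := n) i A).
Proof. by move=> mA; apply: measurable_pow_event => j; case: ifP. Qed.

Lemma pr_coord_event S n i (A : set S) : (i < n)%N -> measurable A ->
  pr (coord_event (n := n) i A) = pr A.
Proof.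
move=> lin mA; rewrite pr_pow_event; last by move=> j; case: ifP.
rewrite (bigD1 (Ordinal lin)) //= eqxx big1 ?mulr1 // => j /eqP ji.
by case: eqP => [e|_]; [case: ji; exact: val_inj|rewrite pr_setT].
Qed.

Lemma size_pow_seq S n (w : pow_space S n) : size (pow_seq w) = n.
Proof. by elim: n w => //= n IH w; rewrite IH. Qed.

(** Markov's inequality for the number X of events that occur: b times the indicator of X >= b is at
    most X, and X has expectation the sum of the probabilities. *)
Lemma pr_markov S (I : finType) (E : I -> set S) (b : nat) : (forall i, measurable (E i)) ->
  measurable [set s | (b <= #|[pred i | `[< E i s >]]|)%N] /\
  b%:R * pr [set s | (b <= #|[pred i | `[< E i s >]]|)%N] <= \sum_i pr (E i).
Proof.
move=> mE; pose X s : R := \sum_i (\1_(E i) s : R).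
have XE s : X s = #|[pred i | `[< E i s >]]|%:R.
  rewrite /X -sum1_card natr_sum [RHS]big_mkcond /=; apply: eq_bigr => i _.
  by rewrite indicE /in_mem /= /in_set; case: ifP.
have mX : measurable_fun setT X.
  by apply: measurable_sum => i; exact: measurable_indic.
set A := [set s | _].
have AE : A = X @^-1` `[b%:R, +oo[.
  by apply/seteqP; split => s /=; rewrite in_itv /= andbT XE ler_nat.
have mA : measurable A by rewrite AE -[_ @^-1` _]setTI; exact: mX.
split => //; rewrite -lee_fin EFinM -prE // -sumEFin.
under eq_bigr do rewrite -prE // -[E _]setIT -integral_indic //.
rewrite -ge0_integral_sum //; last first.
  by move=> i; apply/measurable_EFinP; exact: measurable_indic.
rewrite -[X in (_ * ps_prob S X)%E]setIT -integral_indic // -ge0_integralZl //; last first.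
- by apply/measurable_EFinP; exact: measurable_indic.
apply: ge0_le_integral => //.
- by apply/measurable_EFinP/measurable_funM => //; exact: measurable_indic.
- by apply: emeasurable_sum => i; apply/measurable_EFinP; exact: measurable_indic.
move=> s _; rewrite sumEFin -/(X s) -EFinM lee_fin indicE.
have [h|h] := pselect (A s); last by rewrite memNset // mulr0 XE.
by rewrite mem_set // mulr1 XE ler_nat.
Qed.

End ProbabilitySpaces.

Section UniformNat.
Local Open Scope classical_set_scope.
Variables (R : realType) (n : nat).

(** The average of the Dirac measures at 0, ..., n. It lives on all of [nat], where every set is
    measurable. *)
Definition uniform_nat_prob : set nat -> \bar R :=
  msum (fun i : nat => mscale (n.+1%:R^-1)%:nng (\d_i : {measure set nat -> \bar R})) n.+1.

HB.instance Definition _ := Measure.on uniform_nat_prob.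

Lemma uniform_nat_probE (A : set nat) :
  uniform_nat_prob A = (#|[pred i : 'I_n.+1 | `[< A i >]]|%:R / n.+1%:R)%:E.
Proof.
rewrite /uniform_nat_prob /msum.
transitivity (\sum_(i < n.+1) (n.+1%:R^-1 * (\1_A (i : nat)))%:E : \bar R)%E.
  by apply: eq_bigr => i _; rewrite EFinM.
rewrite sumEFin -mulr_sumr mulrC; congr (EFin (_ / _)).
rewrite -sum1_card natr_sum [RHS]big_mkcond /=; apply: eq_bigr => i _.
by rewrite indicE /in_mem /= /in_set; case: ifP.
Qed.

Lemma uniform_nat_prob_setT : uniform_nat_prob setT = 1%E.
Proof.
rewrite uniform_nat_probE (_ : #|_| = n.+1) ?divff //.
by rewrite -[RHS]card_ord; apply: eq_card => i; rewrite !inE asboolT.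
Qed.

HB.instance Definition _ :=
  @Measure_isProbability.Build _ _ R uniform_nat_prob uniform_nat_prob_setT.

Definition uniform_nat : prob_space R := @ProbSpace R _ nat uniform_nat_prob.

Lemma pr_uniform_nat (A : set uniform_nat) :
  pr A = #|[pred i : 'I_n.+1 | `[< A i >]]|%:R / n.+1%:R.
Proof. by rewrite /pr /= uniform_nat_probE. Qed.

End UniformNat.

(** Redefining a colliding function at b by an arbitrary value is injective: the old value at b can
    still be read off at a. *)
Lemma card_collision (K : finType) (t : nat) (a b : K) : a != b -> (#|[pred f : {ffun K -> 'I_t.+1} | f a == f b]| * t.+1 <= #|{: {ffun K -> 'I_t.+1}}|)%N.
Proof.
move=> ab.
pose change (p : {ffun K -> 'I_t.+1} * 'I_t.+1) : {ffun K -> 'I_t.+1} := [ffun x => if x == b then p.2 else p.1 x].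
pose A := [set f : {ffun K -> 'I_t.+1} | f a == f b].
have -> : (#|[pred f : {ffun K -> 'I_t.+1} | f a == f b]| * t.+1 = #|finset.setX A [set: 'I_t.+1]|)%N.
  by rewrite cardsX cardsE cardsT card_ord.
have ch_inj : {in finset.setX A [set: 'I_t.+1] &, injective change}.
  move=> [f u] [g v]; rewrite !inE /= !andbT => /eqP fab /eqP gab /ffunP e.
  have eb := e b; rewrite !ffunE eqxx /= in eb.
  congr pair => //; apply/ffunP => x; have := e x; rewrite !ffunE.
  case: eqP => [-> _|//]; have := e a; rewrite !ffunE (negbTE ab) /=.
  by rewrite fab gab.
by rewrite -(card_in_imset ch_inj) max_card.
Qed.

Section RandomFunction.
Local Open Scope classical_set_scope.
Variables (R : realType) (K : finType) (t : nat).
Local Notation F := {ffun K -> 'I_t.+1}.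

(** A function is drawn as an index into the enumeration of all functions; [uniform_nat] at n has n
    + 1 outcomes, hence the predecessor. *)
Definition fun_space : prob_space R := uniform_nat R #|{: F}|.-1.

Definition random_fun (i : fun_space) : F := nth [ffun=> ord0] (enum {: F}) i.

Lemma pr_random_fun (a b : K) : a != b ->
  pr [set i : fun_space | random_fun i a = random_fun i b] <= t.+1%:R^-1.
Proof.
move=> ab; rewrite /fun_space pr_uniform_nat.
have F0 : (0 < #|{: F}|)%N by apply/card_gt0P; exists [ffun=> ord0].
rewrite prednK // ler_pdivrMr ?ltr0n // ler_pdivlMl ?ltr0n // -natrM ler_nat mulnC.
apply: leq_trans (card_collision t ab); rewrite leq_mul2r; apply/orP; right.
pose dec (i : 'I_#|{: F}|) : F := nth [ffun=> ord0] (enum {: F}) i.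
have dec_inj : injective dec.
  move=> i j /eqP; rewrite /dec nth_uniq ?enum_uniq //.
  - by move/eqP => ?; exact: val_inj.
  - by rewrite -cardE.
  - by rewrite -cardE.
set D := (X in (#|X| <= _)%N).
rewrite -(card_imset D dec_inj); apply: subset_leq_card; apply/fintype.subsetP => f /imsetP[i].
rewrite inE => /asboolP e ->; rewrite inE; apply/eqP; exact: (asboolW e).
Qed.

End RandomFunction.

(** * One table: concatenated bits and a random slot *)

Section TableHash.
Local Open Scope classical_set_scope.
Variables (R : realType) (X : Type) (S : prob_space R) (g : S -> X -> bool).
Variables (k t : nat).
Hypothesis mg : forall x, measurable [set s | g s x].

Definition table_space : prob_space R :=
  prod_space (pow_space S k) (fun_space R (k.-tuple bool) t).

Fact hash_bits_size (w : pow_space S k) (x : X) : size [seq g s x | s <- pow_seq w] == k.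
Proof. by rewrite size_map size_pow_seq. Qed.

Definition hash_bits (w : pow_space S k) (x : X) : k.-tuple bool := Tuple (hash_bits_size w x).

Definition table_hash (w : table_space) (x : X) : nat :=
  random_fun w.2 (hash_bits w.1 x).

Lemma table_hash_lt w x : (table_hash w x < t.+1)%N.
Proof. exact: ltn_ord. Qed.

Lemma measurable_bit x (b : bool) : measurable [set s | g s x = b].
Proof.
case: b; first exact: mg.
rewrite (_ : [set _ | _] = ~` [set s | g s x]); first exact/measurableC/mg.
by apply/seteqP; split => s /=; case: (g s x).
Qed.

Lemma measurable_agree x y : measurable [set s | g s x = g s y].
Proof.
rewrite (_ : [set _ | _] = ([set s | g s x = true] `&` [set s | g s y = true])
   `|` ([set s | g s x = false] `&` [set s | g s y = false])).
  by apply: measurableU; apply: measurableI; exact: measurable_bit.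
apply/seteqP; split => s /=; first by move=> ->; case: (g s y); [left|right].
by case=> -[-> ->].
Qed.

Lemma hash_bits_agree x y : [set w | hash_bits w x = hash_bits w y] =
  pow_event (n := k) (fun=> [set s | g s x = g s y]).
Proof.
apply/seteqP; split => w /=.
  move=> /(congr1 val) /= e i s iw; have := congr1 (fun l => onth l i) e.
  by rewrite !onth_map iw /= => -[].
move=> h; apply/val_inj/eq_from_onth => i; rewrite /= !onth_map.
by case e: (onth _ i) => [s|] //=; rewrite (h i s e).
Qed.

Lemma hash_bits_eq x (b : k.-tuple bool) : [set w | hash_bits w x = b] =
  pow_event (n := k) (fun i => [set s | Some (g s x) = onth b i]).
Proof.
apply/seteqP; split => w /=.
  by move=> <- i s iw /=; rewrite onth_map iw.
move=> h; apply/val_inj/eq_from_onth => i; rewrite /= onth_map.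
case e: (onth _ i) => [s|] /=; first by rewrite (h i s e).
rewrite onth_default // size_tuple -(size_pow_seq w) -onthNE.
by rewrite e.
Qed.

Lemma measurable_hash_bits_eq x b : measurable [set w | hash_bits w x = b].
Proof.
rewrite hash_bits_eq; apply: measurable_pow_event => i.
case: (onth b i) => [v|]; last first.
  by rewrite (_ : [set _ | _] = set0) //; apply/seteqP; split.
rewrite (_ : [set _ | _] = [set s | g s x = v]); first exact: measurable_bit.
by apply/seteqP; split => s /=; [case|move=> ->].
Qed.

Lemma measurable_table_collision x y : measurable [set w | table_hash w x = table_hash w y].
Proof.
(* A finite union over the possible pairs of keys; for given keys the event is a product. *)
rewrite (_ : [set _ | _] = \bigcup_(b in [set: k.-tuple bool * k.-tuple bool])
  (([set v | hash_bits v x = b.1] `&` [set v | hash_bits v y = b.2]) `*`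
   [set i : fun_space R (k.-tuple bool) t | random_fun i b.1 = random_fun i b.2])).
  apply: fin_bigcup_measurable => // b _.
  by apply: measurableX => //; apply: measurableI; exact: measurable_hash_bits_eq.
apply/seteqP; split => -[v i] /=.
  by move=> /val_inj e; exists (hash_bits v x, hash_bits v y).
by move=> [[b b'] _ /= [[<- <-]]] e; rewrite /table_hash e.
Qed.

Lemma pr_table_collision_ge x y :
  pr [set s | g s x = g s y] ^+ k <= pr [set w | table_hash w x = table_hash w y].
Proof.
have mE := measurable_pow_event k (fun=> measurable_agree x y).
have <- : pr (pow_event (n := k) (fun=> [set s | g s x = g s y]) `*`
    [set: fun_space R (k.-tuple bool) t] : set table_space) = pr [set s | g s x = g s y] ^+ k.
  rewrite pr_setX // pr_setT mulr1 pr_pow_event; last by move=> _; exact: measurable_agree.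
  by rewrite prodr_const card_ord.
apply: pr_le; [exact: measurableX|exact: measurable_table_collision|].
move=> [v i] /= [+ _]; rewrite -hash_bits_agree /= /table_hash /=.
by move=> ->.
Qed.

(** Either all k bits agree or, for fixed bits with different keys, the random function sends both
    keys to the same slot. *)
Lemma pr_table_collision_le x y :
  pr [set w | table_hash w x = table_hash w y] <= pr [set s | g s x = g s y] ^+ k + t.+1%:R^-1.
Proof.
set A := [set s | g s x = g s y]; set C := [set w | _].
have mE := measurable_pow_event k (fun=> measurable_agree x y).
have mC : measurable C := measurable_table_collision x y.
pose E : set table_space := pow_event (n := k) (fun=> A) `*` setT.
have mE' : measurable E by exact: measurableX.
have <- : pr E = pr A ^+ k.
  rewrite pr_setX // pr_setT mulr1 pr_pow_event; last by move=> _; exact: measurable_agree.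
  by rewrite prodr_const card_ord.
have mD : measurable (C `\` E) by exact: measurableD.
apply: (@le_trans _ _ (pr E + pr (C `\` E))).
  apply: le_trans (pr_setU_le mE' mD); apply: pr_le => //; first exact: measurableU.
  by move=> w Cw; have [?|?] := pselect (E w); [left|right].
rewrite lerD2l; apply: pr_xsection_le => //.
move=> v; have [e|ne] := eqVneq (hash_bits v x) (hash_bits v y).
  rewrite (_ : xsection _ _ = set0) ?pr_set0 ?invr_ge0 //.
  apply/seteqP; split => // i; rewrite /xsection /= inE => -[_]; apply; split => //=.
  by rewrite -hash_bits_agree.
apply: le_trans (pr_random_fun R t ne); apply: pr_le => //.
by move=> i; rewrite /xsection /= inE => -[] /= /val_inj.
Qed.

End TableHash.

(** * Several independent tables *)

Section IndependentTables.
Local Open Scope classical_set_scope.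
Variable R : realType.

(** (1 - q)^L (1 + q)^L is at most 1, and (1 + q)^L is at least 1 + L q >= 2 by Bernoulli's
    inequality. *)
Lemma power_complement_le (q : R) (L : nat) : 0 <= q <= 1 -> 1 <= L%:R * q ->
  (1 - q) ^+ L <= 2^-1.
Proof.
move=> q1 Lq.
have bern n : 1 + n%:R * q <= (1 + q) ^+ n.
  elim: n => [|n IH]; first by rewrite mul0r addr0.
  rewrite exprS; apply: le_trans (_ : (1 + q) * (1 + n%:R * q) <= _); last first.
    by rewrite ler_wpM2l //; lra.
  have : 0 <= q * (n%:R * q) by rewrite !mulr_ge0 //; lra.
  by rewrite -natr1 => ?; lra.
have b0 : 0 < (1 + q) ^+ L by apply: exprn_gt0; lra.
rewrite -(ler_pM2r b0) -exprMn.
apply: le_trans (_ : 1 <= _).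
  by apply: exprn_ile1; nra.
by have := bern L; lra.
Qed.

Variables (X : Type) (S : prob_space R) (h : S -> X -> nat) (L : nat).
Hypothesis mh : forall x y, measurable [set s | h s x = h s y].

Definition tables_hash (w : pow_space S L) (l : nat) (x : X) : nat :=
  if onth (pow_seq w) l is Some s then h s x else 0%N.

(** Missing every collision of x and y has probability at most 1/2, and b or more far collisions at
    most 1/4; what is left, 1/4, becomes the success probability of the structure. *)
Lemma tables_success (x y : X) (q p : R) (I : finType) (P : pred I) (far : I -> X * X) (b : nat) :
  0 <= p -> 0 <= q -> q <= pr [set s | h s x = h s y] -> 1 <= L%:R * q ->
  (forall i, P i -> pr [set s | h s (far i).1 = h s (far i).2] <= p) ->
  4 * (L * #|I|)%:R * p <= b%:R -> (0 < b)%N ->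
  exists G : set (pow_space S L), [/\ measurable G, 4^-1 <= pr G &
    forall w, G w ->
      (exists2 l, (l < L)%N & tables_hash w l x = tables_hash w l y) /\
      (#|[pred li : 'I_L * I | P li.2 && (tables_hash w li.1 (far li.2).1 == tables_hash w li.1 (far li.2).2)]| < b)%N].
Proof.
move=> p0 q0 qx Lq farp pb b0.
set C := [set s | h s x = h s y] in qx *.
have mC : measurable C by exact: mh.
pose F i := [set s | h s (far i).1 = h s (far i).2].
pose N : set (pow_space S L) := pow_event (n := L) (fun=> ~` C).
have mN : measurable N by apply: measurable_pow_event => _; exact: measurableC.
pose E (li : 'I_L * I) : set (pow_space S L) := 
  if P li.2 then coord_event (n := L) li.1 (F li.2) else set0.
have mE li : measurable (E li).
  by rewrite /E; case: ifP => // _; apply: measurable_coord_event; exact: mh.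
have [mB prB] := pr_markov b mE.
set B := [set s | _] in mB prB.
exists (~` N `\` B); split.
- by apply: measurableD => //; exact: measurableC.
- apply: le_trans (pr_setD_ge (measurableC mN) mB).
  have prN : pr N <= 2^-1.
    rewrite pr_pow_event; last by move=> _; exact: measurableC.
    rewrite prodr_const card_ord pr_setC //; apply: power_complement_le.
      by rewrite pr_ge0 pr_le1.
    by apply: le_trans Lq _; rewrite ler_wpM2l.
  have prB' : pr B <= 4^-1.
    have bR : 0 < b%:R :> R by rewrite ltr0n.
    rewrite -(ler_pM2l bR); apply: le_trans prB _.
    apply: (@le_trans _ _ (\sum_(li : 'I_L * I) p)).
      apply: ler_sum => li _; rewrite /E; case: ifP => [Pi|_]; last by rewrite pr_set0.
      by rewrite pr_coord_event; [exact: farp|exact: ltn_ord|exact: mh].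
    by rewrite sumr_const card_prod card_ord -[_ *+ _]mulr_natl; lra.
  rewrite pr_setC //; lra.
move=> w [nN nB]; split.
  have [//|no] := pselect (exists2 l, (l < L)%N & tables_hash w l x = tables_hash w l y).
  case: nN => l s ls Cs; apply: no; exists l; last by rewrite /tables_hash ls.
  by rewrite -(size_pow_seq w) -onthTE ls.
rewrite ltnNge; apply/negP => hb; apply: nB; apply: leq_trans hb _.
apply: subset_leq_card; apply/fintype.subsetP => -[l i]; rewrite !inE /= => /andP[Pi /eqP e].
apply/asboolP/asboolP; rewrite /E Pi; apply: (proj2 (coord_eventP _ _ _)) => s ls.
by move: e; rewrite /tables_hash ls.
Qed.

End IndependentTables.

(** * One bit: a random point against a graph *)

Section ThresholdHash.
Local Open Scope classical_set_scope.
Variables (R : realType) (c : R).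
Hypothesis c0 : 0 < c.
Implicit Types f g : R -> R.

Let cNc : - c < c. Proof. by rewrite gt0_cp. Qed.

Definition uniform_space (a b : R) (ab : a < b) : prob_space R :=
  @ProbSpace R _ (measurableTypeR R) (uniform_prob ab).

Definition threshold_space : prob_space R :=
  prod_space (uniform_space (ltr01 : 0 < 1 :> R)) (uniform_space cNc).

Definition below (s : threshold_space) f : bool := s.2 < f s.1.

Lemma measurable_below f : measurable_fun setT f -> measurable [set s | below s f].
Proof.
move=> mf.
have m1 : measurable_fun setT (fun s : threshold_space => s.2 : R).
  exact: measurable_snd.
have m2 : measurable_fun setT (fun s : threshold_space => f s.1).
  exact: measurableT_comp mf measurable_fst.
have := measurable_fun_ltr m1 m2.
move=> /(_ measurableT [set true]); rewrite setTI; apply => //.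
Qed.

Lemma pr_uniform_itv (a b lo hi : R) (ab : a < b) : a <= lo -> lo <= hi -> hi <= b ->
  ps_prob (uniform_space ab) (`[lo, hi[ : set R) = ((hi - lo) / (b - a))%:E.
Proof.
move=> alo lohi hib; rewrite /= /uniform_prob.
rewrite (eq_integral (fun=> (b - a)^-1%:E)); last first.
  move=> x; rewrite inE /= in_itv /= => /andP[lx xh]; rewrite /uniform_pdf ifT //.
  by rewrite (le_trans alo) //= (le_trans (ltW xh)).
rewrite integral_cst //= lebesgue_measure_itv /= lte_fin.
have [lh|lh] := ltP lo hi; first by rewrite -EFinB -EFinM mulrC.
by rewrite (_ : hi - lo = 0) ?mul0r ?mule0 //; lra.
Qed.

(** By Fubini: for a fixed abscissa x the separating ordinates form the interval between f x and g
    x, which lies in [- c, c]. *)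
Lemma pr_disagree f g : locally_integrable f -> locally_integrable g ->
  (forall x, 0 <= x < 1 -> `|f x| <= c) -> (forall x, 0 <= x < 1 -> `|g x| <= c) ->
  pr [set s | below s f != below s g] = itv_integral (fun x => `|f x - g x|) 0 1 / (2 * c).
Proof.
move=> lf lg fc gc; set D := [set s | _].
have mD : measurable D.
  have mf := measurable_below lf.1; have mg := measurable_below lg.1.
  rewrite (_ : D = ([set s | below s f] `\` [set s | below s g])
     `|` ([set s | below s g] `\` [set s | below s f])).
    by apply: measurableU; apply: measurableD.
  apply/seteqP; split => s; rewrite /D /=.
    by case: (below s f); case: (below s g) => //; [left|right].
  by case: (below s f); case: (below s g) => -[] [].
have xs x : 0 <= x < 1 -> ps_prob (uniform_space cNc) (xsection D x) = (`|f x - g x| / (2 * c))%:E.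
  move=> x1; have := fc x x1; have := gc x x1; rewrite !ler_norml => /andP[? ?] /andP[? ?].
  have -> : xsection D x = `[Num.min (f x) (g x), Num.max (f x) (g x)[.
    apply/seteqP; split => y; rewrite /xsection /D /= in_itv /= inE /= /below /= ge_min lt_max.
      by case: (ltP y (f x)); case: (ltP y (g x)) => //= ? ?; rewrite ?orbT.
    by case: (ltP y (f x)); case: (ltP y (g x)).
  have [fg|fg] := leP (f x) (g x).
    by rewrite pr_uniform_itv // distrC ger0_norm ?subr_ge0 //; congr (EFin (_ / _)); lra.
  by rewrite pr_uniform_itv ?(ltW fg) // gtr0_norm ?subr_gt0 //; congr (EFin (_ / _)); lra.
have lfg : locally_integrable (fun x => `|f x - g x|).
  exact/locally_integrable_norm/locally_integrableB.
rewrite /pr /= /product_measure1 /= integral_uniform; last 2 first.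
- exact: (measurable_fun_xsection (uniform_prob cNc)).
- by [].
rewrite subr0 invr1 mul1e -integral_itv_bndo_bndc; last first.
  by apply: measurable_funTS; exact: (measurable_fun_xsection (uniform_prob cNc)).
transitivity (itv_integral (fun x => `|f x - g x| / (2 * c)) 0 1).
  by congr fine; apply: eq_integral => x; rewrite inE /= in_itv /= => /xs.
rewrite [RHS]mulrC -itv_integralZ //; apply: eq_Rintegral => x _.
by rewrite mulrC.
Qed.

Lemma pr_agree f g : locally_integrable f -> locally_integrable g ->
  (forall x, 0 <= x < 1 -> `|f x| <= c) -> (forall x, 0 <= x < 1 -> `|g x| <= c) ->
  pr [set s | below s f = below s g] = 1 - itv_integral (fun x => `|f x - g x|) 0 1 / (2 * c).
Proof.
move=> lf lg fc gc; rewrite -pr_disagree //.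
have mA : measurable [set s | below s f = below s g].
  apply: (@measurable_agree R bool threshold_space (fun s (b : bool) => below s (if b then f else g)) _ true false).
  by case; apply: measurable_below; [case: lf|case: lg].
have -> : [set s | below s f != below s g] = ~` [set s | below s f = below s g].
  by apply/seteqP; split => s /=; move/eqP.
by rewrite pr_setC //; lra.
Qed.

End ThresholdHash.

(** * The word-RAM programs *)

Section WordRam.
Local Open Scope nat_scope.

Lemma mixed_radix_lt a b k l : a < k -> b < l -> a * l + b < k * l.
Proof.
move=> ak bl; apply: (@leq_trans (a.+1 * l)); first by rewrite mulSn addnC ltn_add2r.
by rewrite leq_mul2r ak orbT.
Qed.

(** k is a decreasing variant and c bounds the body; the additional round in the bound pays for the
    final test. *)
Lemma while_exec (Obj : Type) (E : env Obj) (e : expr) (C : cmd)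
    (Inv : nat -> (nat -> nat) * (nat -> nat) -> Prop) (c : nat) :
  (forall k st, Inv k st -> Defs.eval E st.1 e != 0 ->
     exists st' t' k', [/\ exec E C st st' t', t' <= c, k' < k & Inv k' st']) ->
  forall k st, Inv k st -> exists st' t k', [/\ exec E (While e C) st st' t,
     t <= k.+1 * (c + ecost e).+1, Inv k' st' & Defs.eval E st'.1 e = 0].
Proof.
move=> step k; elim/ltn_ind: k => k IH [rg mem] Ik.
have [e0|e0] := eqVneq (Defs.eval E rg e) 0.
  exists (rg, mem), (ecost e).+1, k; split => //; first by apply/ExWhileF/eqP.
  by rewrite -addSn; nia.
have [st1 [t1 [k1 [x1 t1c k1k I1]]]] := step _ _ Ik e0.
have [st2 [t2 [k2 [x2 t2c I2 e2]]]] := IH _ k1k _ I1.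
exists st2, (ecost e + t1 + t2).+1, k2; split => //; first exact: ExWhileT x1 x2.
by nia.
Qed.

(* Registers: 1 counts the entries during preprocessing, 2 = n, 3 = number of
   shifts, 4 = n * shifts, 5 = slots per table, 6 = address of the links, 7 = budget,
   10 = current link, 11 counts the tables and shifts during a query.  Entry e stands
   for shift e mod M of object (e / M) mod n in table e / (n M); links are stored
   incremented, 0 ending a bucket. *)
Definition entry_hash_expr : expr :=
  Bin OAdd (Bin OMul (Bin ODiv (Reg 1) (Reg 4)) (Reg 3)) (Bin OMod (Reg 1) (Reg 3)).

Definition object_expr (x : nat) : expr := Bin OMod (Bin ODiv (Reg x) (Reg 3)) (Reg 2).

Definition insert_entry : cmd :=
  Seq (Assign 1 (Bin OSub (Reg 1) (Const 1)))
 (Seq (Hash 8 entry_hash_expr (object_expr 1))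
 (Seq (Assign 8 (Bin OAdd (Bin OMul (Bin ODiv (Reg 1) (Reg 4)) (Reg 5)) (Reg 8)))
 (Seq (Read 9 (Reg 8))
 (Seq (Write (Bin OAdd (Reg 6) (Reg 1)) (Reg 9))
      (Write (Reg 8) (Bin OAdd (Reg 1) (Const 1))))))).

Definition lsh_pre : cmd := While (Reg 1) insert_entry.

(** Clears the two registers that the loop of the query tests. *)
Definition stop_query : cmd := Seq (Assign 10 (Const 0)) (Assign 11 (Const 0)).

(** A far entry costs one unit of the budget in register 7. Stopping at 0 makes the time bound hold
    for every outcome. *)
Definition visit_entry : cmd :=
  Seq (Assign 10 (Bin OSub (Reg 10) (Const 1)))
 (Seq (Assign 8 (object_expr 10))
 (Seq (Near 9 (Reg 8) (Reg 2))
      (If (Reg 9) (Seq (Assign 0 (Reg 8)) stop_query)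
         (Seq (Assign 7 (Bin OSub (Reg 7) (Const 1)))
              (If (Reg 7) (Read 10 (Bin OAdd (Reg 6) (Reg 10))) stop_query))))).

Definition next_bucket : cmd :=
  Seq (Assign 11 (Bin OSub (Reg 11) (Const 1)))
 (Seq (Hash 8 (Reg 11) (Reg 2))
      (Read 10 (Bin OAdd (Bin OMul (Bin ODiv (Reg 11) (Reg 3)) (Reg 5)) (Reg 8)))).

(** The sum of the two registers stands for a disjunction; it cannot wrap around to 0, because the
    word size exceeds the number of hash functions plus the number of entries. *)
Definition lsh_qry : cmd :=
  While (Bin OAdd (Reg 11) (Reg 10)) (If (Reg 10) visit_entry next_bucket).

(** * Buckets as linked lists *)

Section Buckets.
Variables (total : nat) (slot : nat -> nat).

(** Entries are inserted at the head, from the last one down, so a bucket is increasing; this is its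
    content once e, ..., total - 1 are in. *)
Definition chain (s e : nat) : seq nat := [seq x <- iota e (total - e) | slot x == s].

Definition link (l : seq nat) : nat := if l is e :: _ then e.+1 else 0.

Definition linked (p : nat) : seq nat := if p is e.+1 then e :: chain (slot e) e.+1 else [::].

Lemma chainS s e : e < total ->
  chain s e = if slot e == s then e :: chain s e.+1 else chain s e.+1.
Proof. by move=> et; rewrite /chain -[total - e]prednK ?subn_gt0 // -subnS. Qed.

Lemma chain_ge s e : total <= e -> chain s e = [::].
Proof. by rewrite /chain => /eqP ->. Qed.

(** The head of a bucket reveals its slot, so the stored link determines the rest of the list. *)
Lemma linked_chain s e : linked (link (chain s e)) = chain s e.
Proof.
move: {2}(total - e) (leqnn (total - e)) => k; elim: k e => [|k IH] e ek.
  by rewrite chain_ge //; lia.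
have [te|et] := leqP total e; first by rewrite chain_ge.
rewrite chainS //; case: eqP => [<- //|_]; apply: IH; lia.
Qed.

Lemma link_chain_le s e : link (chain s e) <= total.
Proof.
case c: (chain s e) => [|x l] //=.
have : x \in chain s e by rewrite c mem_head.
by rewrite mem_filter mem_iota => /and3P[_ ex]; lia.
Qed.

End Buckets.

Section Structure.
Variables (Obj : Type) (W n M L T : nat) (hf : nat -> Obj -> nat) (nr : Obj -> Obj -> bool).
Variables (dat : nat -> Obj) (B : nat).
Hypotheses (n0 : 0 < n) (M0 : 0 < M) (T0 : 0 < T) (B0 : 0 < B).
Hypothesis hfT : forall j o, hf j o < T.
Let total := L * (n * M).
Hypothesis W_big : L * T + total + L * M + n * M + n + M + T + B + 2 < W.

Definition lsh_par (x : nat) : nat :=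
  nth 0 [:: 0; total; n; M; n * M; T; L * T; B; 0; 0; 0; L * M] x.

(** The first L T cells hold the heads of the buckets, the following ones the links. Hash function l
    M + i is shift i in table l. *)
Definition lsh_env (objs : nat -> option Obj) : env Obj :=
  Env W (L * T + total) (L * M) hf nr objs.

Definition entry_table e := e %/ (n * M).
Definition entry_object e := (e %/ M) %% n.
Definition entry_slot e :=
  entry_table e * T + hf (entry_table e * M + e %% M) (dat (entry_object e)).

Lemma entry_table_lt e : e < total -> entry_table e < L.
Proof. by move=> et; rewrite /entry_table ltn_divLR ?muln_gt0 ?n0. Qed.

Lemma entry_object_lt e : entry_object e < n.
Proof. by rewrite ltn_mod. Qed.

Lemma entry_hash_lt e : e < total -> entry_table e * M + e %% M < L * M.
Proof.
by move=> /entry_table_lt lt; rewrite mixed_radix_lt // ltn_pmod.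
Qed.

Lemma entry_slot_lt e : e < total -> entry_slot e < L * T.
Proof.
by move=> /entry_table_lt lt; rewrite mixed_radix_lt.
Qed.

Definition params_ok (rg : nat -> nat) : Prop :=
  [/\ rg 2 = n, rg 3 = M, rg 4 = n * M, rg 5 = T & rg 6 = L * T].

(** The invariant of preprocessing: the link of x is the head that x displaced, that is, the part of
    its bucket after x. *)
Definition buckets_from (e : nat) (mem : nat -> nat) : Prop :=
  (forall s, s < L * T -> mem s = link (chain total entry_slot s e)) /\
  (forall x, e <= x < total -> mem (L * T + x) = link (chain total entry_slot (entry_slot x) x.+1)).

Lemma total_lt : total < W.
Proof. by lia. Qed.

Lemma evalB (objs : nat -> option Obj) rg o e1 e2 v1 v2 :
  Defs.eval (lsh_env objs) rg e1 = v1 -> Defs.eval (lsh_env objs) rg e2 = v2 ->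
  eval_binop o v1 v2 < W -> Defs.eval (lsh_env objs) rg (Bin o e1 e2) = eval_binop o v1 v2.
Proof. by move=> /= -> -> vW; rewrite modn_small. Qed.

Lemma eval_const (objs : nat -> option Obj) rg k : k < W ->
  Defs.eval (lsh_env objs) rg (Const k) = k.
Proof. by move=> kW; rewrite /= modn_small. Qed.

Lemma insert_entryP objs e rg mem : (forall a, a < n -> objs a = Some (dat a)) ->
  e < total -> params_ok rg -> rg 1 = e.+1 -> buckets_from e.+1 mem ->
  exists rg' mem' t, [/\ exec (lsh_env objs) insert_entry (rg, mem) (rg', mem') t, t <= 40,
    params_ok rg', rg' 1 = e & buckets_from e mem'].
Proof.
move=> objsE et [r2 r3 r4 r5 r6] r1 [heads links].
have tW := total_lt; have eh := entry_hash_lt et; have es := entry_slot_lt et.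
have eo := entry_object_lt e; have eM := leq_div e M; have em := leq_mod e M.
have el : entry_table e <= e := leq_div _ _.
have x1 := ExAssign (lsh_env objs) rg mem 1 (Bin OSub (Reg 1) (Const 1)).
rewrite (@evalB _ _ _ _ _ e.+1 1) ?eval_const //= in x1; [|lia|lia].
rewrite subn1 /= in x1; set rg1 := upd rg 1 e in x1.
have ev_idx : Defs.eval (lsh_env objs) rg1 entry_hash_expr = entry_table e * M + e %% M.
  rewrite /rg1 /upd /= r3 r4 /= -/(entry_table e) (@modn_small (entry_table e)); last by lia.
  rewrite (@modn_small (_ * M)); last by lia.
  by rewrite (@modn_small (e %% M)) ?(@modn_small (_ + _)) //; lia.
have ev_obj : Defs.eval (lsh_env objs) rg1 (object_expr 1) = entry_object e.
  rewrite /rg1 /upd /= r2 r3 /= (@modn_small (e %/ M)); last by lia.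
  by rewrite -/(entry_object e) modn_small //; lia.
set h := hf (entry_table e * M + e %% M) (dat (entry_object e)).
have hT : h < T by exact: hfT.
have x2 := @ExHash _ (lsh_env objs) rg1 mem 8 entry_hash_expr (object_expr 1) (dat (entry_object e)).
rewrite ev_idx ev_obj /= objsE // -/h (@modn_small h) in x2; last by lia.
have {}x2 := x2 eh erefl.
set rg2 := upd rg1 8 h in x2.
have x3 := ExAssign (lsh_env objs) rg2 mem 8 (Bin OAdd (Bin OMul (Bin ODiv (Reg 1) (Reg 4)) (Reg 5)) (Reg 8)).
have ev_slot : Defs.eval (lsh_env objs) rg2 (Bin OAdd (Bin OMul (Bin ODiv (Reg 1) (Reg 4)) (Reg 5)) (Reg 8))
   = entry_slot e.
  rewrite /rg2 /rg1 /upd /= r4 r5 -/(entry_table e) (@modn_small (entry_table e)); last by lia.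
  rewrite /entry_slot -/h in es *.
  by rewrite (@modn_small (_ * T)) ?(@modn_small (_ + _)) //; lia.
rewrite ev_slot in x3; set rg3 := upd rg2 8 _ in x3.
pose rg4 := upd rg3 9 (mem (entry_slot e)).
have x4 : exec (lsh_env objs) (Read 9 (Reg 8)) (rg3, mem) (rg4, mem) 2.
  by apply: (@ExRead _ (lsh_env objs) rg3 mem 9 (Reg 8)); exact: ltn_addr es.
have x5 := @ExWrite _ (lsh_env objs) rg4 mem (Bin OAdd (Reg 6) (Reg 1)) (Reg 9).
have ev_link : Defs.eval (lsh_env objs) rg4 (Bin OAdd (Reg 6) (Reg 1)) = L * T + e.
  by rewrite /rg4 /rg3 /rg2 /rg1 /upd /= r6 modn_small //; lia.
rewrite ev_link in x5.
have {}x5 := x5 ltac:(rewrite /=; lia).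
set mem1 := upd mem _ _ in x5.
have x6 := @ExWrite _ (lsh_env objs) rg4 mem1 (Reg 8) (Bin OAdd (Reg 1) (Const 1)).
have {}x6 := x6 (ltn_addr _ es).
have ev_e : Defs.eval (lsh_env objs) rg4 (Bin OAdd (Reg 1) (Const 1)) = e.+1.
  by rewrite /rg4 /rg3 /rg2 /rg1 /upd /= (@modn_small 1) ?addn1 ?modn_small //; lia.
rewrite ev_e in x6; pose mem2 := upd mem1 (entry_slot e) e.+1.
exists rg4, mem2; eexists; split.
- exact: ExSeq x1 (ExSeq x2 (ExSeq x3 (ExSeq x4 (ExSeq x5 x6)))).
- by [].
- by split.
- by [].
(* Heads and links occupy disjoint ranges of cells, so the two writes do not interfere. *)
split=> [s sl|x /andP[ex xt]]; rewrite /mem2 /mem1 /upd /=.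
  rewrite chainS //; case: eqVneq => // ne.
  by rewrite ltn_eqF ?heads //; lia.
rewrite gtn_eqF; last by lia.
rewrite eqn_add2l; case: eqVneq => [->|ne]; first by rewrite /rg4 /upd /= heads.
by apply: links; lia.
Qed.

Definition lsh_init (x : nat) : nat := lsh_par x %% W.

Lemma lsh_initE x : lsh_init x = lsh_par x.
Proof.
rewrite /lsh_init modn_small // /lsh_par.
by do 12! [case: x => [|x] /=; first by lia]; rewrite nth_nil; lia.
Qed.

Lemma lsh_init_params : params_ok lsh_init.
Proof. by rewrite /params_ok !lsh_initE. Qed.

Lemma lsh_preP objs : (forall a, a < n -> objs a = Some (dat a)) ->
  exists rg mem t, [/\ exec (lsh_env objs) lsh_pre (lsh_init, fun=> 0) (rg, mem) t,
    t <= 42 * total.+1 & buckets_from 0 mem].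
Proof.
move=> objsE.
pose Inv k (st : (nat -> nat) * (nat -> nat)) :=
  [/\ k <= total, params_ok st.1, st.1 1 = k & buckets_from k st.2].
have step k st : Inv k st -> Defs.eval (lsh_env objs) st.1 (Reg 1) != 0 ->
    exists st' t' k', [/\ exec (lsh_env objs) insert_entry st st' t', t' <= 40, k' < k & Inv k' st'].
  case: st => rg mem [kt]; rewrite /= => ok r1 b; rewrite r1; case: k kt r1 b => // k kt r1 b _.
  have [rg' [mem' [t' [x t40 ok' r1' b']]]] := insert_entryP objsE kt ok r1 b.
  by exists (rg', mem'), t', k; split => //; split => //=; exact: ltnW.
have I0 : Inv total (lsh_init, fun=> 0).
  split => //=; [exact: lsh_init_params|by rewrite lsh_initE|].
  split=> [s _|x /andP[tx xt]]; first by rewrite chain_ge.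
  by move: (leq_trans xt tx); rewrite ltnn.
have [[rg mem] [t [k [x tle [_ _ r1 b] r0]]]] := while_exec step I0.
exists rg, mem, t; split => //; first by rewrite mulnC.
by move: b; rewrite -r1 /= (r0 : rg 1 = 0).
Qed.

Section Query.
Variables (q : Obj) (objs : nat -> option Obj) (mem : nat -> nat).
Hypothesis objsE : forall a, a < n -> objs a = Some (dat a).
Hypothesis objs_q : objs n = Some q.
Hypothesis buckets : buckets_from 0 mem.

Definition query_slot (t : nat) : nat := t %/ M * T + hf t q.

Definition near_entry (e : nat) : bool := nr (dat (entry_object e)) q.

(* The entries still to be visited when [t] pairs of a table and a shift remain
   and [p] is the current link. *)
Definition remaining (t p : nat) : seq nat :=
  linked total entry_slot p ++
  flatten [seq chain total entry_slot (query_slot t') 0 | t' <- rev (iota 0 t)].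

(** Preserved while the query passes far entries: the budget b cannot run out before a near entry is
    met. *)
Definition visited_ok (l : seq nat) (b : nat) : Prop :=
  has near_entry l /\ count (predC near_entry) l < b.

Definition query_ok (rg : nat -> nat) : Prop := rg 0 < n /\ nr (dat (rg 0)) q.

Lemma query_slot_lt t : t < L * M -> query_slot t < L * T.
Proof. by move=> tLM; rewrite mixed_radix_lt // ltn_divLR. Qed.

Lemma next_bucketP rg t : params_ok rg -> rg 11 = t.+1 -> t < L * M ->
  exists rg' t', [/\ exec (lsh_env objs) next_bucket (rg, mem) (rg', mem) t', t' <= 20,
    params_ok rg' & [/\ rg' 0 = rg 0, rg' 7 = rg 7, rg' 11 = t &
    rg' 10 = link (chain total entry_slot (query_slot t) 0)]].
Proof.
move=> [r2 r3 r4 r5 r6] r11 tLM; have qs := query_slot_lt tLM.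
have dt := leq_div t M; have tW := total_lt.
have x1 := ExAssign (lsh_env objs) rg mem 11 (Bin OSub (Reg 11) (Const 1)).
rewrite (@evalB _ _ _ _ _ t.+1 1) ?eval_const //= in x1; [|lia|lia].
rewrite subn1 /= in x1; set rg1 := upd rg 11 t in x1.
pose rg2 := upd rg1 8 (hf t q).
have hT : hf t q < T by exact: hfT.
have x2 : exec (lsh_env objs) (Hash 8 (Reg 11) (Reg 2)) (rg1, mem) (rg2, mem) 3.
  have := @ExHash _ (lsh_env objs) rg1 mem 8 (Reg 11) (Reg 2) q.
  rewrite /= /rg1 /upd /= r2 objs_q (@modn_small (hf t q)); last by lia.
  by move=> x2; exact: x2 tLM erefl.
have ev_slot : Defs.eval (lsh_env objs) rg2
    (Bin OAdd (Bin OMul (Bin ODiv (Reg 11) (Reg 3)) (Reg 5)) (Reg 8)) = query_slot t.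
  rewrite /rg2 /rg1 /upd /= r3 r5 (@modn_small (t %/ M)); last by lia.
  rewrite /query_slot in qs *.
  by rewrite (@modn_small (_ * T)) ?(@modn_small (_ + _)) //; lia.
have x3 := @ExRead _ (lsh_env objs) rg2 mem 10
    (Bin OAdd (Bin OMul (Bin ODiv (Reg 11) (Reg 3)) (Reg 5)) (Reg 8)).
rewrite ev_slot in x3; have {}x3 := x3 (ltn_addr _ qs).
eexists; eexists; split; first exact: ExSeq x1 (ExSeq x2 x3).
- by [].
- by split.
- by split => //; rewrite /upd /=; case: buckets => + _; apply.
Qed.

Lemma remaining_next t :
  remaining t.+1 0 = remaining t (link (chain total entry_slot (query_slot t) 0)).
Proof. by rewrite /remaining linked_chain -addn1 iotaD rev_cat. Qed.

Lemma remaining_visit t e : remaining t e.+1 =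
  e :: remaining t (link (chain total entry_slot (entry_slot e) e.+1)).
Proof. by rewrite /remaining linked_chain. Qed.

Lemma stop_queryP rg : exec (lsh_env objs) stop_query (rg, mem) (upd (upd rg 10 0) 11 0, mem) 4.
Proof.
have x1 := ExAssign (lsh_env objs) rg mem 10 (Const 0).
have x2 := ExAssign (lsh_env objs) (upd rg 10 0) mem 11 (Const 0).
by rewrite /= mod0n in x1 x2; exact: ExSeq x1 x2.
Qed.

Lemma visit_entryP rg e b : params_ok rg -> rg 10 = e.+1 -> rg 7 = b.+1 -> e < total -> b < B ->
  exists rg' t', [/\ exec (lsh_env objs) visit_entry (rg, mem) (rg', mem) t', t' <= 40,
    params_ok rg' &
    [\/ [/\ near_entry e, rg' 0 = entry_object e, rg' 10 = 0 & rg' 11 = 0],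
       [/\ ~~ near_entry e, b = 0, rg' 10 = 0 & rg' 11 = 0] |
       [/\ ~~ near_entry e, 0 < b, rg' 7 = b, rg' 11 = rg 11 &
          rg' 10 = link (chain total entry_slot (entry_slot e) e.+1)]]].
Proof.
move=> [r2 r3 r4 r5 r6] r10 r7 et bB; have tW := total_lt.
have eo := entry_object_lt e; have eM := leq_div e M.
have x1 := ExAssign (lsh_env objs) rg mem 10 (Bin OSub (Reg 10) (Const 1)).
rewrite (@evalB _ _ _ _ _ e.+1 1) ?eval_const //= in x1; [|lia|lia].
rewrite subn1 /= in x1; set rg1 := upd rg 10 e in x1.
have x2 := ExAssign (lsh_env objs) rg1 mem 8 (object_expr 10).
have ev_obj : Defs.eval (lsh_env objs) rg1 (object_expr 10) = entry_object e.
  rewrite /rg1 /upd /= r2 r3 /= (@modn_small (e %/ M)); last by lia.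
  by rewrite -/(entry_object e) modn_small //; lia.
rewrite ev_obj in x2; set rg2 := upd rg1 8 _ in x2.
pose rg3 := upd rg2 9 (near_entry e).
have x3 : exec (lsh_env objs) (Near 9 (Reg 8) (Reg 2)) (rg2, mem) (rg3, mem) 3.
  have := @ExNear _ (lsh_env objs) rg2 mem 9 (Reg 8) (Reg 2) (dat (entry_object e)) q.
  rewrite /= /rg2 /rg1 /upd /= r2 objs_q objsE // -/(near_entry e).
  by rewrite (@modn_small (near_entry e)) => [x3|]; [exact: x3|case: near_entry; lia].
have [ne|ne] := boolP (near_entry e).
  have x4 := ExAssign (lsh_env objs) rg3 mem 0 (Reg 8).
  have x5 := @ExIfT _ (lsh_env objs) rg3 mem (Reg 9) _
    (Seq (Assign 7 (Bin OSub (Reg 7) (Const 1)))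
      (If (Reg 7) (Read 10 (Bin OAdd (Reg 6) (Reg 10))) stop_query)) _ _ _ (ExSeq x4 (stop_queryP _)).
  rewrite {1}/rg3 {1}/upd /= ne in x5; have {}x5 := x5 isT.
  eexists; eexists; split; first exact: ExSeq x1 (ExSeq x2 (ExSeq x3 x5)).
  - by [].
  - by split.
  - by constructor 1.
have x4 := ExAssign (lsh_env objs) rg3 mem 7 (Bin OSub (Reg 7) (Const 1)).
rewrite (@evalB _ _ _ _ _ b.+1 1) ?eval_const //= in x4; [|lia|lia].
rewrite subn1 /= in x4; set rg4 := upd rg3 7 b in x4.
have ne0 : Defs.eval (lsh_env objs) rg3 (Reg 9) == 0.
  by rewrite /= /rg3 /upd /= (negbTE ne).
have [b0|b0] := posnP b.
  have b0' : Defs.eval (lsh_env objs) rg4 (Reg 7) == 0 by rewrite /= /rg4 /upd /= b0.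
  have x5 := @ExIfF _ (lsh_env objs) rg4 mem (Reg 7) (Read 10 (Bin OAdd (Reg 6) (Reg 10)))
    _ _ _ b0' (stop_queryP rg4).
  have x6 := @ExIfF _ (lsh_env objs) rg3 mem (Reg 9) (Seq (Assign 0 (Reg 8)) stop_query)
    _ _ _ ne0 (ExSeq x4 x5).
  eexists; eexists; split; first exact: ExSeq x1 (ExSeq x2 (ExSeq x3 x6)).
  - by [].
  - by split.
  - by constructor 2.
have b0' : Defs.eval (lsh_env objs) rg4 (Reg 7) != 0 by rewrite /= /rg4 /upd /= -lt0n.
have ev_link : Defs.eval (lsh_env objs) rg4 (Bin OAdd (Reg 6) (Reg 10)) = L * T + e.
  by rewrite /rg4 /rg3 /rg2 /rg1 /upd /= r6 modn_small //; lia.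
have rd := @ExRead _ (lsh_env objs) rg4 mem 10 (Bin OAdd (Reg 6) (Reg 10)).
rewrite ev_link in rd; have {}rd := rd ltac:(rewrite /=; lia).
have x5 := @ExIfT _ (lsh_env objs) rg4 mem (Reg 7) _ stop_query _ _ b0' rd.
have x6 := @ExIfF _ (lsh_env objs) rg3 mem (Reg 9) (Seq (Assign 0 (Reg 8)) stop_query)
  _ _ _ ne0 (ExSeq x4 x5).
eexists; eexists; split; first exact: ExSeq x1 (ExSeq x2 (ExSeq x3 x6)).
- by [].
- by split.
- by constructor 3; split => //; rewrite /upd /=; apply: buckets.2.
Qed.

(** The variant is the number of unopened buckets plus the budget, and every active iteration lowers
    one of them or stops. The factor 46 consists of 42 for the body, 3 for the guard and 1 for the
    loop. *)
Lemma lsh_qryP : exists rg t, [/\ exec (lsh_env objs) lsh_qry (lsh_init, mem) (rg, mem) t,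
  t <= 46 * (L * M + B).+1 & visited_ok (remaining (L * M) 0) B -> query_ok rg].
Proof.
set H := visited_ok _ _.
pose active (k : nat) (rg : nat -> nat) := exists t p b, [/\ rg 11 = t, rg 10 = p & rg 7 = b] /\
  [/\ t <= L * M, p <= total, 0 < b <= B, t + b <= k & H -> visited_ok (remaining t p) b].
pose stopped (rg : nat -> nat) := [/\ rg 11 = 0, rg 10 = 0 & H -> query_ok rg].
pose Inv k (st : (nat -> nat) * (nat -> nat)) :=
  [/\ st.2 = mem, params_ok st.1 & active k st.1 \/ stopped st.1].
have tW := total_lt.
have step k st : Inv k st -> Defs.eval (lsh_env objs) st.1 (Bin OAdd (Reg 11) (Reg 10)) != 0 ->
    exists st' t' k', [/\ exec (lsh_env objs) (If (Reg 10) visit_entry next_bucket) st st' t',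
      t' <= 42, k' < k & Inv k' st'].
  case: st => rg m [/= -> ok]; case; last by move=> [-> -> _]; rewrite mod0n.
  move=> [t [p [b [[r11 r10 r7] [tLM pt /andP[b0 bB] tk hb]]]]]; rewrite r11 r10 => tp.
  case: p r10 pt hb tp => [|e] r10 pt hb tp.
    case: t r11 tLM tk hb tp => [|t] r11 tLM tk hb tp; first by rewrite mod0n in tp.
    have [rg' [t' [x t20 ok' [e0 e7 e11 e10]]]] := next_bucketP ok r11 tLM.
    exists (rg', mem), (1 + t').+1, k.-1; split.
    - by apply: ExIfF => //=; rewrite r10.
    - by lia.
    - by lia.
    split => //=; left; exists t, (rg' 10), b; split; first by rewrite e7.
    split=> [|||| /hb]; [lia| |lia|lia|].
      by rewrite e10 link_chain_le.
    by rewrite remaining_next e10.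
  case: b r7 b0 bB tk hb => // b r7 _ bB tk hb.
  have [rg' [t' [x t40 ok' cases]]] := visit_entryP ok r10 r7 pt bB.
  exists (rg', mem), (1 + t').+1, k.-1; split.
  - by apply: ExIfT => //=; rewrite r10.
  - by lia.
  - by lia.
  rewrite remaining_visit in hb.
  split => //=; case: cases => [[ne e0 e10 e11]|[ne bz e10 e11]|[ne bp e7 e11 e10]].
  - by right; split => // _; rewrite /query_ok e0; split; [exact: entry_object_lt|exact: ne].
  - by right; split => // /hb[_]; rewrite /= ne bz; lia.
  left; exists t, (rg' 10), b; split; first by rewrite e11 r11 e7.
  split=> [|||| /hb]; [lia| |lia|lia|].
    by rewrite e10 link_chain_le.
  rewrite -e10 => -[]; rewrite /= (negbTE ne) /= => h1 h2.
  by split => //; lia.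
have I0 : Inv (L * M + B) (lsh_init, mem).
  split => //=; first exact: lsh_init_params.
  left; exists (L * M), 0, B; split; first by rewrite !lsh_initE.
  by split => //; rewrite B0 leqnn.
have [[rg m] [t [k [x tle [em _ act] r0]]]] := while_exec step I0.
rewrite /= in em act r0; rewrite em in x.
exists rg, t; split => //; first by rewrite mulnC.
(* If the loop ended without stopping, nothing would remain to be visited, although the invariant
   promises a near entry. *)
case: act => [[t' [p [b [[r11 r10 _] [tLM pt _ _ hb]]]]] /hb|[_ _]//].
move: r0; rewrite r11 r10 modn_small; last by lia.
by move/eqP; rewrite addn_eq0 => /andP[/eqP -> /eqP ->] [].
Qed.

Lemma remaining_all t : remaining t 0 =
  flatten [seq chain total entry_slot (query_slot t') 0 | t' <- rev (iota 0 t)].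
Proof. by []. Qed.

Lemma entry_slot_query e t : (entry_slot e == query_slot t) =
  (entry_table e == t %/ M) && (hf (entry_table e * M + e %% M) (dat (entry_object e)) == hf t q).
Proof.
rewrite /entry_slot /query_slot; apply/idP/andP => [/eqP eq_slot|[/eqP -> /eqP ->]] //.
have quo x h : h < T -> (x * T + h) %/ T = x by move=> hT; rewrite divnMDl // divn_small // addn0.
have rem x h : h < T -> (x * T + h) %% T = h by move=> hT; rewrite modnMDl modn_small.
have := congr1 (fun x => x %/ T) eq_slot; have := congr1 (fun x => x %% T) eq_slot.
by rewrite !quo // !rem // => -> ->.
Qed.

Lemma remaining_has l a i j : l < L -> a < n -> i < M -> j < M ->
  nr (dat a) q -> hf (l * M + i) (dat a) = hf (l * M + j) q ->
  has near_entry (remaining (L * M) 0).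
Proof.
move=> lL an iM jM nra hE; pose e := (l * n + a) * M + i; pose t := l * M + j.
have eM : e %/ M = l * n + a by rewrite divnMDl // divn_small // addn0.
have em : e %% M = i by rewrite modnMDl modn_small.
have et : entry_table e = l.
  by rewrite /entry_table mulnC divnMA eM divnMDl // divn_small // addn0.
have eo : entry_object e = a by rewrite /entry_object eM modnMDl modn_small.
have tM : t %/ M = l by rewrite divnMDl // divn_small // addn0.
apply/hasP; exists e; last by rewrite /near_entry eo.
rewrite remaining_all; apply/flattenP; exists (chain total entry_slot (query_slot t) 0).
  by apply: map_f; rewrite mem_rev mem_iota /= mixed_radix_lt.
rewrite mem_filter mem_iota /= subn0 entry_slot_query et tM eqxx em eo hE eqxx /=.
by rewrite /total mulnA mixed_radix_lt // mixed_radix_lt.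
Qed.

(** An entry can turn up under several shifts of the query, so visits are counted as pairs (t, e).
    The table is common to t and e, and together with the object and the two shifts it determines
    the pair. *)
Lemma remaining_count : 0 < L -> count (predC near_entry) (remaining (L * M) 0) <=
  #|[pred x : 'I_L * ('I_n * 'I_M * 'I_M) | ~~ nr (dat x.2.1.1) q &&
      (hf (x.1 * M + x.2.1.2) (dat x.2.1.1) == hf (x.1 * M + x.2.2) q)]|.
Proof.
move=> L0; set C := [pred x | _].
pose phi (x : nat * nat) : 'I_L * ('I_n * 'I_M * 'I_M) :=
  (Ordinal (ltn_pmod (x.1 %/ M) L0), (Ordinal (ltn_pmod (x.2 %/ M) n0),
     Ordinal (ltn_pmod x.2 M0), Ordinal (ltn_pmod x.1 M0))).
pose far t := [seq e <- chain total entry_slot (query_slot t) 0 | ~~ near_entry e].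
pose s := [seq (t, e) | t <- rev (iota 0 (L * M)), e <- far t].
have sP t e : (t, e) \in s ->
    [/\ t < L * M, e < total, entry_table e = t %/ M, ~~ near_entry e &
        hf (entry_table e * M + e %% M) (dat (entry_object e)) = hf t q].
  case/allpairsPdep => t' [e' [+ + [-> ->]]].
  rewrite mem_rev mem_iota /= mem_filter => tL /andP[ne].
  rewrite mem_filter mem_iota /= subn0 entry_slot_query => /andP[/andP[/eqP h1 /eqP h2] et].
  by split.
have -> : count (predC near_entry) (remaining (L * M) 0) = size s.
  rewrite remaining_all count_flatten size_allpairs_dep -map_comp.
  by congr sumn; apply: eq_map => t; rewrite /= -size_filter.
have uniq_s : uniq s.
  apply: allpairs_uniq_dep.
  - by rewrite rev_uniq iota_uniq.
  - by move=> t _; rewrite !filter_uniq // iota_uniq.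
  - by move=> [t e] [t' e'] _ _ /= [-> ->].
have phi_inj : {in s &, injective phi}.
  move=> [t e] [t' e'] /sP[tL et tab _ _] /sP[tL' et' tab' _ _] [/= h1 h2 h3 h4].
  have small x : x < L * M -> (x %/ M) %% L = x %/ M.
    by move=> xL; rewrite modn_small // ltn_divLR.
  rewrite !small // in h1.
  have tt' : t = t' by rewrite (divn_eq t M) h1 h4 -divn_eq.
  have ee : e %/ M = e' %/ M.
    have quo x : x %/ M %/ n = entry_table x by rewrite /entry_table mulnC divnMA.
    by rewrite (divn_eq (e %/ M) n) h2 quo tab h1 -tab' -quo -divn_eq.
  by rewrite tt' (divn_eq e M) ee h3 -divn_eq.
rewrite -(size_map phi) -(card_uniqP _); last by rewrite map_inj_in_uniq.
apply/subset_leq_card/fintype.subsetP => _ /mapP[[t e] /sP[tL et tab ne hE] ->].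
rewrite inE /= (@modn_small (t %/ M)) ?ltn_divLR // -/(entry_object e) -/(near_entry e) ne /=.
by rewrite -{1}tab hE -divn_eq.
Qed.

End Query.

End Structure.
End WordRam.

(** * The data structure *)

Section LshOfTables.
Local Open Scope classical_set_scope.
Variables (R : realType) (Obj : Type) (d : Obj -> Obj -> R) (A : Obj -> Prop).
Variables (r s : R) (S : prob_space R) (h : S -> Obj * nat -> nat).
Variables (n M L T B W : nat) (q p : R) (space ptime qtime : R).
Hypotheses (n0 : (0 < n)%N) (M0 : (0 < M)%N) (L0 : (0 < L)%N) (T0 : (0 < T)%N) (B0 : (0 < B)%N).
Hypothesis hT : forall w x, (h w x < T)%N.
Hypothesis mh : forall x y, measurable [set w | h w x = h w y].
Hypothesis rs : r <= s.
Hypothesis collide_near : forall x y, A x -> A y -> d x y <= r ->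
  exists i j, [/\ (i < M)%N, (j < M)%N & q <= pr [set w | h w (x, i) = h w (y, j)]].
Hypothesis collide_far : forall x y i j, A x -> A y -> ~~ (d x y <= s) ->
  pr [set w | h w (x, i) = h w (y, j)] <= p.
Hypotheses (p0 : 0 <= p) (q0 : 0 <= q) (Lq : 1 <= L%:R * q).
Hypothesis pB : 4 * (L * (n * M * M))%:R * p <= B%:R.
Hypothesis W_big : (L * T + L * (n * M) + L * M + n * M + n + M + T + B + 2 < W)%N.
Hypothesis space_bound : (L * T + L * (n * M) + L * M)%:R <= space.
Hypothesis ptime_bound : (L * M + 42 * (L * (n * M)).+1)%:R <= ptime.
Hypothesis qtime_bound : (46 * (L * M + B).+1)%:R <= qtime.

Lemma lsh_of_tables : lsh_structure d A r s 4^-1 n W lsh_pre lsh_qry space ptime qtime.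
Proof.
pose hf (w : pow_space S L) (j : nat) (o : Obj) := tables_hash h w (j %/ M) (o, (j %% M)%N).
have hfT w j o : (hf w j o < T)%N.
  by rewrite /hf /tables_hash; case: onth.
have hfE w l i o : (i < M)%N -> hf w (l * M + i)%N o = tables_hash h w l (o, i).
  by move=> iM; rewrite /hf divnMDl // divn_small // addn0 modnMDl modn_small.
exists _, (pow_space S L), (ps_prob (pow_space S L)), (L * M)%N, hf, (L * T + L * (n * M))%N,
  (lsh_par n M L T B).
move=> E init; split; first exact: space_bound.
move=> data Adata.
pose dat (a : nat) := data (Ordinal (ltn_pmod a n0)).
have dataE a : (a < n)%N -> data_objects data a = Some (dat a).
  move=> an; rewrite /data_objects insubT /=; congr (Some (data _)).
  by apply: val_inj; rewrite /= modn_small.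
pose nr (x y : Obj) := d x y <= s.
have pre w : exists mem, exists rg t, [/\ exec (E w (data_objects data)) lsh_pre (init, fun=> 0%N) (rg, mem) t,
    (t <= 42 * (L * (n * M)).+1)%N & buckets_from n M L T (hf w) dat 0 mem].
  have [rg [mem [t x]]] := lsh_preP nr n0 M0 T0 B0 (hfT w) W_big dataE.
  by exists mem, rg, t.
have [mem memP] := choice pre.
exists mem; split.
  move=> w; have [rg [t [x tle _]]] := memP w; exists rg, t; split => //.
  by apply: le_trans ptime_bound; rewrite ler_nat leq_add2l.
move=> q' Aq.
have dataE' a : (a < n)%N -> query_objects data q' a = Some (dat a).
  by move=> an; rewrite /query_objects ltn_eqF // dataE.
have queryE : query_objects data q' n = Some q' by rewrite /query_objects eqxx.
pose visited (w : pow_space S L) := visited_ok n M nr dat q' (remaining n M L T (hf w) dat q' (L * M) 0) B.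
have qry w : exists ans, exists rg t,
   [/\ exec (E w (query_objects data q')) lsh_qry (init, mem w) (rg, mem w) t,
     (t <= 46 * (L * M + B).+1)%N, ans = rg 0%N & visited w -> query_ok n nr dat q' rg].
  have [_ [_ [_ _ b]]] := memP w.
  have [rg [t [x tle ok]]] := lsh_qryP nr n0 M0 T0 B0 (hfT w) W_big dataE' queryE b.
  by exists (rg 0%N), rg, t.
have [answer answerP] := choice qry.
exists answer; split.
  move=> w; have [rg [t [x tle e _]]] := answerP w; exists rg, t; split => //.
  by apply: le_trans qtime_bound; rewrite ler_nat.
move=> [i0 di0].
have [i [j [iM jM qij]]] := collide_near (Adata i0) Aq di0.
(* A triple consists of a data object, one of its shifts and a shift of the query. *)
pose P (x : 'I_n * 'I_M * 'I_M) := ~~ nr (dat x.1.1) q'.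
pose far (x : 'I_n * 'I_M * 'I_M) := ((dat x.1.1, x.1.2 : nat), (q', x.2 : nat)).
have [G [mG prG GP]] := @tables_success R _ S h L mh (data i0, i) (q', j) q p
  ('I_n * 'I_M * 'I_M)%type P far B p0 q0 qij Lq
  (fun x Px => collide_far x.1.2 x.2 (Adata _) Aq Px)
  ltac:(rewrite !card_prod !card_ord; exact: pB) B0.
exists G; split => //; first by rewrite prE // lee_fin.
move=> w /GP[[l lL el] fewer].
have vis : visited w.
  split.
    apply: (remaining_has n0 M0 T0 (hfT w) lL (ltn_ord i0) iM jM).
    - by rewrite /nr /dat (_ : Ordinal _ = i0) ?(le_trans di0) //; apply: val_inj; rewrite /= modn_small.
    - rewrite !hfE // -el /dat (_ : Ordinal _ = i0) //.
      by apply: val_inj; rewrite /= modn_small.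
  apply: leq_ltn_trans fewer; apply: leq_trans (remaining_count nr dat n0 M0 T0 (hfT w) q' L0) _.
  apply: subset_leq_card; apply/fintype.subsetP => x; rewrite !inE /P /far /= => /andP[-> /=].
  by rewrite !hfE.
have [rg [t [_ _ -> ok]]] := answerP w.
have [rn rq] := ok vis.
exists (Ordinal rn); split => //; move: rq; rewrite /nr /dat.
by rewrite (_ : Ordinal (ltn_pmod _ _) = Ordinal rn) //; apply: val_inj; rewrite /= modn_small.
Qed.

End LshOfTables.

(** * Choice of the parameters *)

Section Numerics.
Variable R : realType.

Lemma ler_ln_ratio (p1 p2 : R) : 0 < p2 -> p2 <= p1 -> p1 < 1 -> 0 <= ln p1 / ln p2 <= 1.
Proof.
move=> p20 p12 p11.
have l1 : ln p1 < 0 by apply: ln_lt0; lra.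
have l2 : ln p2 < 0 by apply: ln_lt0; lra.
have l12 : ln p2 <= ln p1 by rewrite ler_ln ?posrE //; lra.
rewrite -[ln p2]opprK invrN mulrN -mulNr divr_ge0; [|lra..].
by rewrite ler_pdivrMr /=; lra.
Qed.

(** For the real number y = ln N / ln (1 / p2) one has p2^y = 1 / N and p1^y = N^(- rho). Rounding
    up to an integer keeps the first bound and costs at most one factor p1 in the second. *)
Lemma exists_concatenation (p1 p2 N : R) : 0 < p2 -> p2 <= p1 -> p1 < 1 -> 1 <= N ->
  exists k : nat, p2 ^+ k <= N^-1 /\ p1 * N `^ (- (ln p1 / ln p2)) <= p1 ^+ k.
Proof.
move=> p20 p12 p11 N1; have p10 : 0 < p1 by lra.
have l1 : ln p1 < 0 by apply: ln_lt0; lra.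
have l2 : ln p2 < 0 by apply: ln_lt0; lra.
have lN : 0 <= ln N by exact: ln_ge0.
have N0 : 0 < N by lra.
pose y := ln N / - ln p2; have y0 : 0 <= y by rewrite divr_ge0 //; lra.
have yE : y * - ln p2 = ln N by rewrite divfK //; apply/eqP; lra.
exists (Num.truncn y).+1.
have ky := truncnS_gt y; have [ky' _] := andP (truncn_itv y0).
rewrite -natr1 in ky.
set k := Num.truncn y in ky ky' *.
have exprE (x : R) : 0 < x -> x ^+ k.+1 = expR (k.+1%:R * ln x).
  by move=> x0; rewrite mulr_natl -lnXn // lnK // posrE exprn_gt0.
split.
  rewrite exprE // -[N^-1]lnK ?posrE ?invr_gt0 // ler_expR lnV ?posrE // -yE -natr1.
  have : 0 <= (k%:R + 1 - y) * - ln p2 by rewrite mulr_ge0 //; lra.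
  by lra.
rewrite exprE // -{1}[p1]lnK ?posrE // -[N `^ _]lnK ?posrE ?powR_gt0 // -expRD ler_expR ln_powR.
have -> : - (ln p1 / ln p2) * ln N = y * ln p1.
  by rewrite -yE; field; apply/eqP; lra.
rewrite -natr1.
have : 0 <= (y - k%:R) * - ln p1 by rewrite mulr_ge0 //; lra.
by lra.
Qed.

(** The factor 2 is reserved for replacing 1 by 2 ln (n m) in the query time. *)
Lemma query_steps_le (a b : nat) : (0 < a)%N -> (b <= 8 * a)%N ->
  (46 * (a + b).+1 * 2 <= 10 * (10 * (10 * a)))%N.
Proof. by lia. Qed.

Lemma structure_bounds (C rh : R) (m n L T B k1 c0 : nat) :
  (10 * (10 * 10) <= c0)%N ->
  (3 <= m)%N -> (0 < n)%N -> 0 <= rh <= 1 -> 1 <= C -> (0 < L)%N ->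
  L%:R <= C * (n * m ^ 2)%:R `^ rh -> (T <= n * m ^ 2)%N -> (B <= 8 * (L * m ^ 2))%N ->
  20 * C <= k1%:R ->
  [/\ (L * T + L * (n * m ^ 2) + L * m ^ 2 + n * m ^ 2 + n + m ^ 2 + T + B + 2 < (n * m) ^ (4 + k1))%N,
     (L * T + L * (n * m ^ 2) + L * m ^ 2)%:R <= c0%:R * C * (n * m ^ 2)%:R `^ (1 + rh),
     (L * m ^ 2 + 42 * (L * (n * m ^ 2)).+1)%:R <= c0%:R * C * (n * m ^ 2)%:R `^ (1 + rh) &
     (46 * (L * m ^ 2 + B).+1)%:R <= c0%:R * C * (m%:R `^ (2 + 2 * rh) * n%:R `^ rh * ln (n * m)%:R)].
Proof.
move=> c0_big m3 n0 rh01 C1 L0 LC TN BL kC.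
set M := (m ^ 2)%N in LC TN BL *; set N := (n * M)%N in LC TN *.
have M0 : (0 < M)%N by rewrite expn_gt0 (leq_trans _ m3).
have N0 : (0 < N)%N by rewrite muln_gt0 n0.
have N1 : 1 <= N%:R :> R by rewrite ler1n.
have MN : (M <= N)%N by rewrite leq_pmull.
have nN : (n <= N)%N by rewrite leq_pmulr.
have LM_LN : (L * M <= L * N)%N by rewrite leq_mul2l MN orbT.
have N_LN : (N <= L * N)%N by rewrite leq_pmull.
have M_LM : (M <= L * M)%N by rewrite leq_pmull.
have LT_LN : (L * T <= L * N)%N by rewrite leq_mul2l TN orbT.
have LN0 : (0 < L * N)%N by rewrite muln_gt0 L0.
have LM0 : (0 < L * M)%N by rewrite muln_gt0 L0.
have LN_R : (L * N)%:R <= C * N%:R `^ (1 + rh).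
  rewrite natrM powRD; last by apply/implyP => _; rewrite gt_eqF //; lra.
  by rewrite powRr1 // mulrCA mulrC ler_wpM2l.
have c0_le (x y : nat) : (x <= 10 * (10 * (10 * y)))%N -> x%:R <= c0%:R * y%:R :> R.
  move=> xy; by rewrite -natrM ler_nat (leq_trans xy) // !mulnA leq_mul2r -!mulnA c0_big orbT.
have big_le (x : nat) : (x <= 10 * (10 * (10 * (L * N))))%N -> x%:R <= c0%:R * C * N%:R `^ (1 + rh).
  by move=> /c0_le /le_trans; apply; rewrite -mulrA ler_wpM2l ?ler0n.
split; last first.
(* Rests on m^2 (n m^2)^rh = m^(2 + 2 rh) n^rh. *)
- have LM_R : (L * M)%:R <= C * (m%:R `^ (2 + 2 * rh) * n%:R `^ rh).
    rewrite natrM; apply: (@le_trans _ _ (C * N%:R `^ rh * M%:R)); first by rewrite ler_wpM2r.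
    rewrite -mulrA ler_wpM2l //; first by lra.
    rewrite /N natrM powRM // powRD; last first.
      by apply/implyP => _; rewrite gt_eqF // ltr0n (leq_trans _ m3).
    have -> : m%:R `^ 2 = M%:R :> R by rewrite powR_mulrn // natrX.
    rewrite powRrM powR_mulrn // -natrX -/M.
    by rewrite mulrC [M%:R * _ * _]mulrAC mulrA.
  (* ln (1 + x) <= x at x = - 2/3 gives ln 3 >= 2/3. *)
  have ln_nm : 2^-1 <= ln (n * m)%:R :> R.
    apply: (@le_trans _ _ (ln 3)); last first.
      have nm3 : (3 <= n * m)%N by rewrite (leq_trans m3) // leq_pmull.
      by rewrite ler_ln ?posrE ?ltr0n ?ler_nat // (leq_trans _ nm3).
    have := @le_ln1Dx R (- (2 / 3)); have -> : 1 + - (2 / 3) = 3^-1 :> R by field.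
    by rewrite lnV ?posrE // => h; have := h ltac:(lra); lra.
  set Z := m%:R `^ _ * _ in LM_R *.
  have Z0 : 0 <= C * Z by rewrite !mulr_ge0 ?powR_ge0 //; lra.
  have Zln : 0 <= (C * Z) * (ln (n * m)%:R - 2^-1) by rewrite mulr_ge0 //; lra.
  have h1 : (46 * (L * M + B).+1)%:R * 2 <= c0%:R * (L * M)%:R :> R.
    by rewrite -natrM; apply: c0_le; exact: query_steps_le.
  have h2 : c0%:R * (L * M)%:R <= c0%:R * (C * Z) by rewrite ler_wpM2l ?ler0n.
  have h3 : 0 <= c0%:R * ((C * Z) * (ln (n * m)%:R - 2^-1)) by rewrite mulr_ge0 ?ler0n.
  by lra.
- by apply: big_le; lia.
- by apply: big_le; lia.
(* 20 L N <= 20 C N^2 <= k1 (n m)^4, and k1 < (n m)^k1: the exponent of the word size absorbs the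
   constant. *)
have small : (20 * (L * N) < (n * m) ^ (4 + k1))%N.
  rewrite expnD -(ltr_nat R) natrM (@le_lt_trans _ _ (((n * m) ^ 4)%:R * k1%:R)) //.
    rewrite natrM; apply: (@le_trans _ _ (20 * (C * N%:R * N%:R))).
      rewrite ler_wpM2l // ler_wpM2r // (le_trans LC) // ler_wpM2l //; first by lra.
      by rewrite -[leRHS]powRr1 // ler_powR //; lra.
    apply: (@le_trans _ _ (N%:R * N%:R * k1%:R)).
      have : 0 <= (k1%:R - 20 * C) * (N%:R * N%:R) by rewrite mulr_ge0 //; lra.
      by lra.
    rewrite ler_wpM2r // -natrM ler_nat /N /M.
    by rewrite (_ : 4 = 2 + 2)%N // expnD leq_mul // expnMn leq_mul // -{1}(expn1 n) leq_pexp2l.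
  rewrite natrM ltr_pM2l; last by rewrite ltr0n expn_gt0 muln_gt0 n0 (leq_trans _ m3).
  by rewrite ltr_nat ltn_expl //; nia.
by apply: leq_ltn_trans small; lia.
Qed.

End Numerics.

(** * Hash bits of polygons *)

Section PolygonHash.
Local Open Scope classical_set_scope.
Variables (R : realType) (m : nat).
Hypothesis m0 : (0 < m)%N.

Local Notation bound := (lambda R m + 4 * pi).

Lemma value_bound_gt0 : 0 < bound.
Proof. by rewrite addr_gt0 ?lambda_gt0 // mulr_gt0 ?pi_gt0. Qed.

Let half_bound_gt0 : 0 < bound / 2.
Proof. by rewrite divr_gt0 // value_bound_gt0. Qed.

(** The ordinate ranges over an interval of length lambda + 4 pi, so that two bits differ with
    probability the distance over the denominator in [rho]. *)
Definition polygon_space : prob_space R := threshold_space half_bound_gt0.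

(* Shift i of a polygon starts at vertex i / m and is 0 at vertex i mod m. *)
Definition polygon_bit (s : polygon_space) (x : polygon R * nat) : bool :=
  below s (polygon_canonical x.1 (x.2 %/ m) (x.2 %% m)).

Lemma measurable_polygon_bit x : measurable [set s | polygon_bit s x].
Proof. by apply: measurable_below; case: (polygon_canonical_integrable x.1 (x.2 %/ m) (x.2 %% m)). Qed.

Lemma pr_polygon_bit P Q i j : (size (verts P) <= m)%N -> (size (verts Q) <= m)%N ->
  pr [set s | polygon_bit s (P, i) = polygon_bit s (Q, j)] =
  1 - polygon_canonical_dist P Q (i %/ m) (i %% m) (j %/ m) (j %% m) / bound.
Proof.
move=> Pm Qm; have small (P' : polygon R) a b x : (size (verts P') <= m)%N -> 0 <= x < 1 ->
    `|polygon_canonical P' a b x| <= bound / 2.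
  move=> P'm x1; apply: le_trans (polygon_canonical_bound a b P'm x1) _.
  by rewrite ler_pM2r ?invr_gt0 // lerDl mulr_ge0 // pi_ge0.
rewrite /polygon_bit pr_agree /=; first by congr (_ - _ / _); field.
- exact: polygon_canonical_integrable.
- exact: polygon_canonical_integrable.
- by move=> x; exact: small.
- by move=> x; exact: small.
Qed.

Lemma pr_polygon_bit_near P Q (r : R) : (size (verts P) <= m)%N -> (size (verts Q) <= m)%N ->
  D1 P Q <= r -> exists i j, [/\ (i < m ^ 2)%N, (j < m ^ 2)%N &
    1 - r / bound <= pr [set s | polygon_bit s (P, i) = polygon_bit s (Q, j)]].
Proof.
move=> Pm Qm PQr; have [a [b [a' [b' [am bm am' bm' h]]]]] := exists_canonical_le_D1 P Q.
have idx x y : (y < m)%N -> ((x * m + y) %/ m = x)%N /\ ((x * m + y) %% m = y)%N.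
  by move=> ym; rewrite divnMDl // divn_small // addn0 modnMDl modn_small.
have lt x y : (x < m)%N -> (y < m)%N -> (x * m + y < m ^ 2)%N.
  by move=> xm ym; rewrite mixed_radix_lt.
exists (a * m + b)%N, (a' * m + b')%N; split.
- by apply: lt; apply: leq_trans Pm.
- by apply: lt; apply: leq_trans Qm.
rewrite pr_polygon_bit //.
have [-> ->] := idx a b (leq_trans bm Pm); have [-> ->] := idx a' b' (leq_trans bm' Qm).
by rewrite lerD2l lerN2 ler_pM2r ?invr_gt0 ?value_bound_gt0 // (le_trans h).
Qed.

(** A polygon with fewer than m vertices also meets indices beyond its size; [D1_le_canonical]
    covers them, as it holds for all indices. *)
Lemma pr_polygon_bit_far P Q (s : R) i j : (size (verts P) <= m)%N -> (size (verts Q) <= m)%N ->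
  ~~ (D1 P Q <= s) ->
  pr [set w | polygon_bit w (P, i) = polygon_bit w (Q, j)] <= 1 - s / bound.
Proof.
rewrite -ltNge => Pm Qm sPQ; rewrite pr_polygon_bit // lerD2l lerN2.
rewrite ler_pM2r ?invr_gt0 ?value_bound_gt0 // (le_trans (ltW sPQ)) //.
exact: D1_le_canonical.
Qed.

End PolygonHash.

Theorem theoremC4 (R : realType) :
  exists p0 : R, 0 < p0 /\
  forall r c : R, 0 < r -> 1 < c ->
  exists (pre qry : cmd) (kappa : nat) (K : R),
  forall m n : nat, (3 <= m)%N -> (0 < n)%N ->
    lsh_structure (@D1 R) (fun P : polygon R => (size (verts P) <= m)%N)
      r (c * r) p0 n ((n * m) ^ kappa)%N pre qry
      (K * (n * m ^ 2)%:R `^ (1 + rho m r c))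
      (K * (n * m ^ 2)%:R `^ (1 + rho m r c))
      (K * (m%:R `^ (2 + 2 * rho m r c) * n%:R `^ rho m r c
            * ln (n * m)%:R)).
Proof.
exists 4^-1; split => // r c r0 c1.
(* c / (c - 1) bounds 1 / p1 whatever m and n are, and the summand 1 pays for rounding up the number
   of tables. *)
pose C := c / (c - 1) + 1; have cc0 : 0 <= c / (c - 1) by rewrite divr_ge0 //; lra.
have C1 : 1 <= C by rewrite lerDr.
pose k1 := (Num.truncn (20 * C)).+1.
have k1C : 20 * C <= k1%:R by exact/ltW/truncnS_gt.
pose c0 := (10 * (10 * 10))%N.
exists lsh_pre, lsh_qry, (4 + k1)%N, (c0%:R * C) => m n m3 n0.
have m0 : (0 < m)%N by exact: leq_trans m3.
have M0 : (0 < m ^ 2)%N by rewrite expn_gt0 m0.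
have N0 : (0 < n * m ^ 2)%N by rewrite muln_gt0 n0.
have b0 := value_bound_gt0 R m.
have rs : r <= c * r by rewrite ler_peMl // ltW.
have c0E : (10 * (10 * 10) <= c0)%N by [].
(* If c r reaches the bound, [ln] takes its default value 0 in the denominator, so [rho] is 0. Every
   object is then within c r, and one table with a single slot and budget 1 suffices. *)
have [far|near] := leP (lambda R m + 4 * pi) (c * r).
  have rho0 : rho m r c = 0.
    rewrite /rho [X in _ / X](_ : _ = 0) ?invr0 ?mulr0 //.
    by apply: ln0; rewrite subr_le0 ler_pdivlMr // mul1r.
  have rh : 0 <= (0 : R) <= 1 by lra.
  have LC : 1%:R <= C * (n * m ^ 2)%:R `^ 0 by rewrite powRr0 mulr1.
  have BM : (1 <= 8 * (1 * m ^ 2))%N by rewrite mul1n muln_gt0.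
  have [Wb sb pb qb] := structure_bounds c0E m3 n0 rh C1 (ltn0Sn 0) LC N0 BM k1C.
  rewrite rho0; apply: (@lsh_of_tables _ _ _ _ _ _ (unit_space R) (fun _ _ => 0%N) n (m ^ 2) 1 1 1 _ 1 0) => //.
  - move=> P Q Pm Qm _; exists 0%N, 0%N; split => //.
    by rewrite (_ : [set _ | _]%classic = setT%classic) ?pr_setT //; apply/seteqP; split.
  - move=> P Q i j Pm Qm; rewrite (le_trans (D1_le_lambda Pm Qm)) //.
    by apply: le_trans far; rewrite lerDl mulr_ge0 // pi_ge0.
  - by rewrite mul1r.
  - by rewrite mulr0.
set Lam := lambda R m + 4 * pi in b0 near.
pose p1 := 1 - r / Lam; pose p2 := 1 - c * r / Lam; pose rh := rho m r c.
have r_Lam : 0 < r / Lam by rewrite divr_gt0.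
have cr_Lam : c * (r / Lam) < 1 by rewrite mulrA ltr_pdivrMr // mul1r.
have p1_lt1 : p1 < 1 by rewrite /p1; lra.
have p2_gt0 : 0 < p2 by rewrite /p2 -mulrA; lra.
have p21 : p2 <= p1 by rewrite lerD2l lerN2 ler_pM2r ?invr_gt0.
(* From c r < Lam follows r / Lam < 1 / c. *)
have p1_gt : (c - 1) / c <= p1.
  rewrite ler_pdivrMr; last by lra.
  by rewrite /p1; have := cr_Lam; lra.
have p1_gt0 : 0 < p1 by lra.
have rh01 : 0 <= rh <= 1 := ler_ln_ratio p2_gt0 p21 p1_lt1.
set N := (n * m ^ 2)%N in N0.
have NR1 : 1 <= N%:R :> R by rewrite ler1n.
have [k [kN kq]] := exists_concatenation p2_gt0 p21 p1_lt1 NR1.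
have Nrh0 : 0 < N%:R `^ rh by apply: powR_gt0; lra.
have Nrh1 : 1 <= N%:R `^ rh by rewrite -[leLHS](powRr0 N%:R) ler_powR //; lra.
(* The least integer above N^rho / p1, the inverse of the guaranteed collision probability in one
   table. *)
pose L := (Num.truncn (N%:R `^ rh / p1)).+1.
have Lgt : N%:R `^ rh / p1 < L%:R by exact: truncnS_gt.
have Lle : L%:R <= C * N%:R `^ rh.
  have : (Num.truncn (N%:R `^ rh / p1))%:R <= N%:R `^ rh / p1.
    by rewrite truncn_le divr_ge0 ?ltW.
  have : N%:R `^ rh / p1 <= N%:R `^ rh * (c / (c - 1)).
    rewrite ler_pM2l // -[c / _]invf_div lef_pV2 ?posrE // divr_gt0; lra.
  by rewrite /C /L -natr1; lra.
have L0 : (0 < L)%N by [].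
clearbody L.
have LM0 : (0 < 8 * (L * m ^ 2))%N by rewrite !muln_gt0 L0 m0.
have [Wb sb pb qb] := structure_bounds c0E m3 n0 rh01 C1 L0 Lle (leqnn N) (leqnn _) k1C.
have T_E : N.-1.+1 = N by rewrite prednK.
apply: (@lsh_of_tables _ _ _ _ _ _ (table_space (polygon_space R m) k N.-1)
  (@table_hash _ _ _ (@polygon_bit R m) k N.-1) n (m ^ 2) L N (8 * (L * m ^ 2)) _ (p1 ^+ k) (2 / N%:R)) => //.
- by move=> w x; rewrite -{2}T_E table_hash_lt.
- by move=> x y; exact: (measurable_table_collision (@measurable_polygon_bit R m)).
- move=> P Q Pm Qm PQr.
  have [i [j [im jm h]]] := pr_polygon_bit_near m0 Pm Qm PQr.
  exists i, j; split => //.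
  apply: le_trans (pr_table_collision_ge _ _ (@measurable_polygon_bit R m) _ _).
  by apply: lerXn2r => //; rewrite nnegrE; [exact: ltW|exact: pr_ge0].
- move=> P Q i j Pm Qm PQ.
  apply: le_trans (pr_table_collision_le _ _ (@measurable_polygon_bit R m) _ _) _.
  (* One summand 1 / N is for agreement of all k bits, the other for a collision of the random
     function into N slots. *)
  rewrite T_E (_ : 2 / N%:R = N%:R^-1 + N%:R^-1); last by field; rewrite pnatr_eq0 -lt0n.
  rewrite lerD2r; apply: le_trans kN; apply: lerXn2r.
  + by rewrite nnegrE pr_ge0.
  + by rewrite nnegrE ltW.
  + exact: pr_polygon_bit_far.
- by rewrite exprn_ge0 // ltW.
- apply: le_trans (_ : L%:R * (p1 * N%:R `^ (- rh)) <= _); last by rewrite ler_wpM2l.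
  by rewrite powRN -/rh mulrA ler_pdivlMr // mul1r -ler_pdivrMr // ltW.
(* There are L n m^2 m^2 far triples of probability at most 2 / N each, hence 2 L m^2 expected
   collisions; the budget is four times this number. *)
- have -> : 4 * (L * (n * m ^ 2 * m ^ 2))%:R * (2 / N%:R) = (8 * (L * m ^ 2))%:R :> R.
    by rewrite !natrM; field; rewrite !pnatr_eq0 -!lt0n m0 n0.
  by [].
Qed.
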